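(* Let $\Pi=(\pi_n)_{n\in\mathbb{N}}$ be a sequence of partitions of $\mathbb{R}_{\ge 0}$ with $|\pi_n|\to 0$. Let $X\in QV(\Pi)$ and let $$\mathcal{E}(X)_t=\exp\Big(X_t-X_0-\frac12[X,X]^{\mathrm{c}}_t\Big)\prod_{0<s\le t}(1+\Delta X_s)e^{-\Delta X_s},\qquad t\ge0.$$ Then $\mathcal{E}(X)$ is the unique solution to the homogeneous linear equation $$Y_t=1+\int_0^tY_{s-}\,dX_s ,\qquad t\ge0,$$ where a solution is an admissible integrand $Y$ of $X$ that satisfies the equation.
   Context: Conventions. A càdlàg path is a function on $\mathbb{R}_{\ge 0}$ that is right continuous with finite left limits; $X_{0-}=X_0$, $\Delta X_t=X_t-X_{t-}$. A partition is $\pi=(t_i)_{i\in\mathbb{N}}$ with $0=t_0<t_1<\cdots\to\infty$, and $|\pi|=\sup_i|t_{i+1}-t_i|$. Quadratic variation. A real càdlàg path $X$ has quadratic variation along $\Pi=(\pi_n)$ if $t\mapsto\sum_{t_i\in\pi_n}(X_{t_{i+1}\wedge t}-X_{t_i\wedge t})^2$ converges pointwise to a càdlàg increasing function $[X,X]$ with $\Delta[X,X]_t=(\Delta X_t)^2$ for all $t\ge0$. $QV(\Pi)$ is the set of such paths. $FV_{\mathrm{loc}}$ is the set of real càdlàg paths of locally finite variation; for $A\in FV_{\mathrm{loc}}$, its continuous part is $A^{\mathrm{c}}_t=A_t-\sum_{0<s\le t}\Delta A_s$. Itô–Föllmer integral. For real càdlàg $\xi$ and $X$, $\int_0^t\xi_{s-}\,dX_s:=\lim_{n\to\infty}\sum_{t_i\in\pi_n}\xi_{t_i}(X_{t_{i+1}\wedge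 t}-X_{t_i\wedge t})$; it is said to exist if this limit exists and is finite. Admissible integrands. A function $f(a,x)$ on an open $U\subset\mathbb{R}^m\times\mathbb{R}$ is of class $C^{1,2}$ if it is once continuously differentiable in $a$ and twice in $x$, with all these derivatives continuous in $(a,x)$ jointly. A real càdlàg path $\xi$ is an admissible integrand of $X\in QV(\Pi)$ if for any $T>0$ there exist $m\in\mathbb{N}$, an open $U\subset\mathbb{R}^m\times\mathbb{R}$, a real function $f$ of class $C^{1,2}$ on $U$, and $A\in FV_{\mathrm{loc}}^m$ such that $\xi_t=\frac{\partial f}{\partial x}(A_t,X_t)$ for all $t\in[0,T]$ and the image of $[0,T]\ni t\mapsto(A_t,X_t)\in U$ is relatively compact in $U$. For an admissible integrand $\xi$ of $X$ the integral $\int_0^t\xi_{s-}\,dX_s$ exists for all $t\ge0$. *)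

(* Defs.v *)
(* A path on the half line is represented by a total function R -> R of which
   only the restriction to the nonnegative reals matters: at times t >= 0, no
   definition below depends on the values of a path at negative times. *)
From mathcomp Require Import all_boot all_order all_algebra finmap.
From mathcomp Require Import all_classical all_reals all_analysis.
From mathcomp Require summability.

Set Implicit Arguments.
Unset Strict Implicit.
Unset Printing Implicit Defensive.

Import Order.TTheory GRing.Theory Num.Theory.
Import numFieldNormedType.Exports.

Local Open Scope classical_set_scope.
Local Open Scope ring_scope.

Section paths.
Context {R : realType}.
Implicit Types (A X xi : R -> R) (t : R).

Definition cadlag X : Prop :=
  (forall t, 0 <= t -> X s @[s --> t^'+] --> X t) /\
  (forall t, 0 < t -> cvg (X s @[s --> t^'-])).

(* The first branch is the convention X_{0-} = X_0. *)
Definition left_lim X t : R :=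
  if t <= 0 then X 0 else lim (X s @[s --> t^'-]).

Definition jump X t : R := X t - left_lim X t.

(* Sums and products over the uncountable index set ]0, t] are unordered: they
   are limits along the net of finite subsets, directed by inclusion. *)
Definition sum_upto (u : R -> R) t : R :=
  lim ((fun J : {fset R} => \sum_(s <- J | 0 < s <= t) u s)
         @ summability.totally).

Definition prod_upto (u : R -> R) t : R :=
  lim ((fun J : {fset R} => \prod_(s <- J | 0 < s <= t) u s)
         @ summability.totally).

Definition FV_loc A : Prop :=
  cadlag A /\ forall T : R, 0 < T -> bounded_variation 0 T A.

Definition continuous_part A t : R := A t - sum_upto (jump A) t.

End paths.

Section partitions.
Context {R : realType}.
Implicit Types (p : nat -> R) (Pi : nat -> nat -> R) (X xi : R -> R) (t : R).

Definition is_partition p : Prop :=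
  [/\ p 0%N = 0, forall i, p i < p i.+1 & p i @[i --> \oo] --> +oo].

Definition mesh p : \bar R :=
  ereal_sup (range (fun i => `|p i.+1 - p i|%:E)).

(* In the two series below only the finitely many terms with p i < t are
   nonzero when p is a partition. *)
Definition qv_sum p X t : R :=
  limn (series (fun i =>
    (X (Num.min (p i.+1) t) - X (Num.min (p i) t)) ^+ 2)).

Definition qv Pi X t : R := limn (fun n => qv_sum (Pi n) X t).

Definition QV Pi X : Prop :=
  [/\ cadlag X,
      forall t, 0 <= t -> cvgn (fun n => qv_sum (Pi n) X t),
      cadlag (qv Pi X),
      {in `[0, +oo[ &, nondecreasing_fun (qv Pi X)} &
      forall t, 0 <= t -> jump (qv Pi X) t = jump X t ^+ 2].

Definition ito_sum p xi X t : R :=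
  limn (series (fun i =>
    xi (p i) * (X (Num.min (p i.+1) t) - X (Num.min (p i) t)))).

Definition ito_integrable Pi xi X t : Prop :=
  cvgn (fun n => ito_sum (Pi n) xi X t).

Definition ito_integral Pi xi X t : R :=
  limn (fun n => ito_sum (Pi n) xi X t).

End partitions.

Section C12.
Context {R : realType} {m : nat}.
Implicit Types (f : 'rV[R]_m * R -> R) (U : set ('rV[R]_m * R)).

Definition dir_a (i : 'I_m) : 'rV[R]_m * R := (delta_mx 0 i, 0).
Definition dir_x : 'rV[R]_m * R := (0, 1).

(* U is meant to be open, so that the derivatives and the continuity of the
   derivatives at a point of U only depend on the restriction of f to U. *)
Definition C12_on U f : Prop :=
  forall p, U p ->
  [/\ forall i, derivable f p (dir_a i) /\ {for p, continuous ('D_(dir_a i) f)},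
      derivable f p dir_x /\ {for p, continuous ('D_dir_x f)} &
      derivable ('D_dir_x f) p dir_x /\
      {for p, continuous ('D_dir_x ('D_dir_x f))}].

(* The closure of K relative to U is compact. *)
Definition relatively_compact_in U (K : set ('rV[R]_m * R)) : Prop :=
  K `<=` U /\ compact (closure K `&` U).

End C12.

Section equation.
Context {R : realType}.
Implicit Types (Pi : nat -> nat -> R) (X xi Y : R -> R) (t : R).

Definition admissible_integrand X xi : Prop :=
  cadlag xi /\
  forall T : R, 0 < T ->
    exists (m : nat) (U : set ('rV[R]_m * R)) (f : 'rV[R]_m * R -> R)
           (A : 'I_m -> R -> R),
      let AX t := (\row_i A i t, X t) in
      [/\ open U, C12_on U f, forall i, FV_loc (A i),
          forall t, 0 <= t <= T -> xi t = 'D_dir_x f (AX t) &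
          relatively_compact_in U (AX @` `[0, T])].

Definition doleans_dade Pi X t : R :=
  expR (X t - X 0 - 2^-1 * continuous_part (qv Pi X) t) *
  prod_upto (fun s => (1 + jump X s) * expR (- jump X s)) t.

Definition linear_solution Pi X Y : Prop :=
  admissible_integrand X Y /\
  forall t, 0 <= t ->
    ito_integrable Pi Y X t /\ Y t = 1 + ito_integral Pi Y X t.

End equation.

(* Main.v *)
Require Import Defs.
From mathcomp Require Import all_boot all_order all_algebra finmap.
From mathcomp Require Import all_classical all_reals all_analysis.
From mathcomp Require Import ring lra.

Set Implicit Arguments.
Unset Strict Implicit.
Unset Printing Implicit Defensive.

Import Order.TTheory GRing.Theory Num.Theory.
Import numFieldNormedType.Exports.

Local Open Scope classical_set_scope.
Local Open Scope ring_scope.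

(** Why the theorem holds. Write R_Y(x, y) = Y_y - Y_x - Y_x (X_y - X_x) for the
    error of an Euler step on [x, y]. A path Y with Y_0 = 1 solves the equation
    if and only if the sums of R_Y over the intervals that the n-th partition
    cuts out of [0, t] tend to 0, for every t. Everything is deduced from this form.

    The main tool, psum_vanish, says that such sums vanish for a functional of
    intervals which is locally, on each side of each time u, a constant times a
    functional whose sums vanish, up to a small multiple of a functional with
    bounded sums, provided that the interval that straddles u is negligible.
    Real induction replaces partitions adapted to the paths.

    Uniqueness. If Y = f_x(A, X), then expanding f first in x and then in a
    shows that f(A, X) has the increments of the integral of Y dX up to
    O(|dA| + (dX)^2), with constants that are uniform by compactness
    (taylor_compact). For a solution this gives
    |R_Y(x, y)| <= N_y - N_x + C (X_y - X_x)^2 with N increasing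
    (controlled_of_primitive), and then Y_u - Y_{u-} = Y_{u-} (X_u - X_{u-})
    (solution_jump). These facts pass to the difference D of two solutions. As
    the errors R_D have bounded absolute sums and vanishing sums, their sums
    weighted by exp(- X) vanish as well (psum_weighted). Hence G = exp(- X) D
    satisfies |dG| <= |G| d[X, X] locally, and G stays 0 once it is 0
    (solution_eq0).

    Existence. The exponential is Z = W exp X, with W of locally finite
    variation: the jump product converges absolutely because
    (1 + z) exp(- z) - 1 = O(z^2) and the squared jumps of X are the jumps of
    [X, X]. So Z = f_x(W, X) with f(a, x) = a exp x, and Z is admissible. Away
    from large jumps, a second order expansion gives
    R_Z(x, y) = Z_x / 2 ((X_y - X_x)^2 - ([X, X]_y - [X, X]_x)) up to smaller
    terms (doleans_dade_local), and the sums of (dX)^2 - d[X, X] tend to 0. At a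
    jump z of X the error is Z_{u-} ((1 + z) exp(- z) exp z - 1 - z) = 0. So
    psum_vanish applies. *)

(** * Real induction and cadlag paths *)

Section real_line.
Context {R : realType}.
Implicit Types (X Y : R -> R) (s t u : R).

Lemma mulr_div_succ_le (a e : R) : 0 <= a -> 0 <= e -> a * (e / (a + 1)) <= e.
Proof.
move=> a0 e0; have a1 : 0 < a + 1 by rewrite ltr_wpDl.
by rewrite mulrCA ler_piMr// ler_pdivrMr// mul1r lerDl.
Qed.

(** Induction along the half line, proved by looking at the infimum of the
    times at which P fails. It replaces the choice of a finite grid adapted to
    a cadlag path: such a path is controlled on a right neighbourhood and on a
    punctured left neighbourhood of each time, which is what the two
    hypotheses offer. *)
Lemma real_induction (P : R -> Prop) :
  P 0 ->
  (forall u, 0 <= u -> P u ->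
     exists2 d, 0 < d & forall t, u < t < u + d -> P t) ->
  (forall u, 0 < u -> (forall t, 0 <= t < u -> P t) -> P u) ->
  forall t, 0 <= t -> P t.
Proof.
move=> P0 Pright Pleft t t0; apply: contrapT => nPt.
pose E := [set x | 0 <= x /\ ~ P x].
have E0 : E !=set0 by exists t.
have lbE : has_lbound E by exists 0 => x [].
have i0 : 0 <= inf E by apply: lb_le_inf => // x [].
have below x : 0 <= x < inf E -> P x.
  move=> /andP[x0 xi]; apply: contrapT => nPx.
  by have := ge_inf lbE (conj x0 nPx); rewrite leNgt xi.
have Pi : P (inf E).
  have [->//|ine] := eqVneq (inf E) 0.
  by apply: Pleft => //; rewrite lt0r ine.
have [d d0 Pd] := Pright _ i0 Pi.
have [x [x0 nPx] xi] := @inf_adherent _ E d d0 (conj E0 lbE).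
have := ge_inf lbE (conj x0 nPx); rewrite le_eqVlt => /orP[/eqP ix|ix].
  by apply: nPx; rewrite -ix.
by apply: nPx; apply: Pd; rewrite ix.
Qed.

Lemma left_approach u d : 0 < u -> 0 < d ->
  exists s, [/\ 0 <= s, u - d < s & s < u].
Proof.
move=> u0 d0; exists (Num.max (u / 2) (u - d / 2)).
split; rewrite ?le_max ?lt_max ?gt_max.
- by apply/orP; left; lra.
- by apply/orP; right; lra.
- by apply/andP; split; lra.
Qed.

Lemma near_rightP u (P : R -> Prop) :
  (\forall s \near u^'+, P s) <->
  exists2 d, 0 < d & forall s, u < s < u + d -> P s.
Proof.
split=> [[d /= d0 Pd]|[d d0 Pd]].
  exists d => // s /andP[us sd]; apply: Pd => //=.
  by rewrite distrC gtr0_norm ?subr_gt0// ltrBlDl.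
near=> s; apply: Pd; apply/andP; split; near: s.
  exact: nbhs_right_gt.
by apply: nbhs_right_lt; rewrite ltrDl.
Unshelve. all: by end_near. Qed.

Lemma near_leftP u (P : R -> Prop) :
  (\forall s \near u^'-, P s) <->
  exists2 d, 0 < d & forall s, u - d < s < u -> P s.
Proof.
split=> [[d /= d0 Pd]|[d d0 Pd]].
  exists d => // s /andP[us sd]; apply: Pd => //=.
  by rewrite gtr0_norm ?subr_gt0// ltrBlDl -ltrBlDr.
near=> s; apply: Pd; apply/andP; split; near: s.
  by apply: nbhs_left_gt; rewrite ltrBlDr ltrDl.
exact: nbhs_left_lt.
Unshelve. all: by end_near. Qed.

Lemma cadlag_right X u e : cadlag X -> 0 <= u -> 0 < e ->
  exists2 d, 0 < d & forall s, u <= s < u + d -> `|X s - X u| <= e.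
Proof.
move=> [Xr _] u0 e0.
have /cvgrPdist_le/(_ e e0)/near_rightP[d d0 Xd] := Xr u u0.
exists d => // s /andP[]; rewrite le_eqVlt => /orP[/eqP <- _|us sd].
  by rewrite subrr normr0 ltW.
by rewrite distrC Xd// us.
Qed.

Lemma cadlag_left X u e : cadlag X -> 0 < u -> 0 < e ->
  exists2 d, 0 < d &
    forall s, u - d < s < u -> `|X s - left_lim X u| <= e.
Proof.
move=> [_ Xl] u0 e0; rewrite /left_lim leNgt u0/=.
have /cvgrPdist_le/(_ e e0)/near_leftP[d d0 Xd] := Xl u u0.
by exists d => // s sd; rewrite distrC Xd.
Qed.

End real_line.

(** * Sums over a partition of an interval *)

Section partition_sums.
Context {R : realType}.
Implicit Types (p : nat -> R) (r m : R -> R -> R) (s t u x y : R).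

(** Clamping a partition to [s, t] turns a sum over the partition stopped at s
    and t into a sum over a partition of [s, t]. *)
Definition clamp s t x := Num.max s (Num.min x t).

(** The test drops the intervals that clamping collapses to a point, so that an
    interval functional need not vanish on the diagonal. *)
Definition psum_term p r s t (i : nat) : R :=
  if clamp s t (p i) < clamp s t (p i.+1)
  then r (clamp s t (p i)) (clamp s t (p i.+1)) else 0.

(** The sum over a partition of [s, t] of a functional r of intervals. The
    quadratic variation sums and the Riemann sums of the integral are the cases
    r x y = (X y - X x) ^+ 2 and r x y = xi x * (X y - X x). *)
Definition psum p r s t : R := limn (series (psum_term p r s t)).

Definition sq_incr (X : R -> R) x y := (X y - X x) ^+ 2.

(** The error made on one interval when dY = Y dX is solved by an Euler step:
    a path that starts at 1 solves it exactly when these errors sum to 0 in the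
    limit. *)
Definition linear_error (X Y : R -> R) x y := Y y - Y x - Y x * (X y - X x).

Lemma clamp_le s t x : s <= t -> x <= s -> clamp s t x = s.
Proof.
move=> st xs; rewrite /clamp (min_idPl (le_trans xs st)).
exact/max_idPl.
Qed.

Lemma clamp_ge s t x : s <= t -> t <= x -> clamp s t x = t.
Proof. by move=> st tx; rewrite /clamp (min_idPr tx) (max_idPr st). Qed.

Lemma clamp_mono s t : s <= t -> {homo clamp s t : x y / x <= y}.
Proof.
move=> st x y xy; rewrite /clamp ge_max !le_max lexx/= le_min !ge_min xy lexx.
by rewrite !orbT.
Qed.

Lemma clamp_in s t x : s <= t -> s <= clamp s t x <= t.
Proof. by move=> st; rewrite /clamp le_max lexx/= ge_max st ge_min lexx orbT. Qed.

Section one_partition.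
Variable p : nat -> R.
Hypothesis p_partition : is_partition p.

Let p0 : p 0%N = 0. Proof. by case: p_partition. Qed.

Lemma partition_homo : {homo p : i j / (i <= j)%N >-> i <= j}.
Proof.
by apply: homo_leq => // [y x z|i]; [exact: le_trans|case: p_partition => _ /(_ i)/ltW].
Qed.

Lemma partition_exceeds t : exists N, t <= p N.
Proof.
have [_ _ /cvgryPge/(_ t)[N _ pN]] := p_partition.
by exists N; apply: pN => /=.
Qed.

Lemma partition_bracketl u : 0 <= u -> exists k, p k <= u < p k.+1.
Proof.
move=> u0; have ex : exists N, u < p N.
  have [N uN] := partition_exceeds (u + 1).
  by exists N; rewrite (lt_le_trans _ uN)// ltrDl.
case: (ex_minnP ex) => -[|k] uk kmin; first by rewrite p0 ltNge u0 in uk.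
by exists k; rewrite uk andbT leNgt; apply/negP => /kmin; rewrite ltnn.
Qed.

Lemma partition_bracketr u : 0 < u -> exists k, p k < u <= p k.+1.
Proof.
move=> u0; have ex := partition_exceeds u.
case: (ex_minnP ex) => -[|k] uk kmin; first by rewrite p0 leNgt u0 in uk.
by exists k; rewrite uk andbT ltNge; apply/negP => /kmin; rewrite ltnn.
Qed.

Lemma psumE N r s t : s <= t -> t <= p N ->
  psum p r s t = \sum_(i < N) psum_term p r s t i.
Proof.
move=> st tN; apply/cvg_lim => //.
apply: cvg_near_cst; exists N => // n /= Nn.
rewrite /series/= (big_cat_nat (leq0n N) Nn)//= big_mkord.
have tp j : (N <= j)%N -> clamp s t (p j) = t.
  by move=> Nj; rewrite clamp_ge// (le_trans tN)// partition_homo.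
rewrite -[RHS]addr0; congr (_ + _).
rewrite big_nat_cond big1// => i /andP[/andP[Ni _] _].
by rewrite /psum_term !tp// ?ltxx// leqW.
Qed.

Lemma psum_le r m s t : s <= t ->
  (forall x y, s <= x -> x < y -> y <= t -> `|r x y| <= m x y) ->
  `|psum p r s t| <= psum p m s t.
Proof.
move=> st rm; have [N tN] := partition_exceeds t.
rewrite !(psumE _ st tN); apply: le_trans (ler_norm_sum _ _ _) _.
apply: ler_sum => i _; rewrite /psum_term; case: ifPn => [lt_|]; last first.
  by rewrite normr0.
have /andP[? ?] := clamp_in (p i) st; have /andP[? ?] := clamp_in (p i.+1) st.
exact: rm.
Qed.

Lemma eq_psum r r' s t : s <= t ->
  (forall x y, s <= x -> x < y -> y <= t -> r x y = r' x y) ->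
  psum p r s t = psum p r' s t.
Proof.
move=> st rr'; have [N tN] := partition_exceeds t.
rewrite !(psumE _ st tN); apply: eq_bigr => i _; rewrite /psum_term.
case: ifPn => // lt_.
have /andP[? ?] := clamp_in (p i) st; have /andP[? ?] := clamp_in (p i.+1) st.
exact: rr'.
Qed.

Lemma psum_lin a b r r' s t : s <= t ->
  psum p (fun x y => a * r x y + b * r' x y) s t =
  a * psum p r s t + b * psum p r' s t.
Proof.
move=> st; have [N tN] := partition_exceeds t.
rewrite !(psumE _ st tN) !mulr_sumr -big_split/=.
by apply: eq_bigr => i _; rewrite /psum_term; case: ifPn => // _; rewrite !mulr0 addr0.
Qed.

Lemma psumD r r' s t : s <= t ->
  psum p (fun x y => r x y + r' x y) s t = psum p r s t + psum p r' s t.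
Proof.
move=> st; rewrite -[psum p r s t]mul1r -[psum p r' s t]mul1r -psum_lin//.
by apply: eq_psum => // x y _ _ _; rewrite !mul1r.
Qed.

Lemma psumB r r' s t : s <= t ->
  psum p (fun x y => r x y - r' x y) s t = psum p r s t - psum p r' s t.
Proof.
move=> st; rewrite -[psum p r s t]mul1r -[- psum p r' s t]mulN1r -psum_lin//.
apply: eq_psum => // x y _ _ _; by rewrite mulN1r mul1r.
Qed.

Lemma psumZ c r s t : s <= t ->
  psum p (fun x y => c * r x y) s t = c * psum p r s t.
Proof.
move=> st; rewrite -[c * _]addr0 -[0 in RHS](mul0r (psum p r s t)) -psum_lin//.
by apply: eq_psum => // x y _ _ _; rewrite mul0r addr0.
Qed.

Lemma psum_telescope (g : R -> R) s t : 0 <= s -> s <= t ->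
  psum p (fun x y => g y - g x) s t = g t - g s.
Proof.
move=> s0 st; have [N tN] := partition_exceeds t.
rewrite (psumE _ st tN).
rewrite (eq_bigr (fun i : 'I_N => g (clamp s t (p i.+1)) - g (clamp s t (p i)))).
  rewrite -(big_mkord xpredT (fun i => g (clamp s t (p i.+1)) - g (clamp s t (p i)))).
  by rewrite telescope_sumr// clamp_ge// clamp_le// p0.
move=> i _; rewrite /psum_term; case: ifPn => //; rewrite -leNgt => le_.
suff -> : clamp s t (p i.+1) = clamp s t (p i) by rewrite subrr.
by apply/le_anti; rewrite le_ clamp_mono// partition_homo.
Qed.

(** Cutting at u changes only the interval [x, y] of the partition that
    straddles u, whence the correction r x y - r x u - r u y. *)
Lemma psum_split r s u t : 0 <= s -> s <= u -> u <= t ->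
  psum p r s t = psum p r s u + psum p r u t \/
  exists k, exists x y,
    [/\ s <= x, x < u, u < y, y <= t & p k <= x /\ y <= p k.+1] /\
    psum p r s t = psum p r s u + psum p r u t + (r x y - r x u - r u y).
Proof.
move=> s0 su ut; have st := le_trans su ut.
have [N tN] := partition_exceeds t; have uN := le_trans ut tN.
have [k /andP[ku uk]] := partition_bracketl (le_trans s0 su).
have [kN|] := ltnP k N; last first.
  move=> /partition_homo Nk.
  have tu : t = u by apply/le_anti; rewrite ut (le_trans tN)// (le_trans Nk).
  left; rewrite tu (psumE r (lexx u) uN) [X in _ + X]big1 ?addr0// => i _.
  suff cu z : clamp u u z = u by rewrite /psum_term !cu ltxx.
  by apply/le_anti; rewrite andbC clamp_in.
have diff : psum p r s t = psum p r s u + psum p r u t +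
    (psum_term p r s t k - psum_term p r s u k - psum_term p r u t k).
  rewrite (psumE _ su uN) (psumE _ ut tN) (psumE _ st tN).
  have D (f : nat -> R) :
      \sum_(i < N) f i = f k + \sum_(i < N | i != Ordinal kN) f i.
    by rewrite (bigD1 (Ordinal kN)).
  rewrite !D.
  set a := \sum_(i < N | _) _; set b := \sum_(i < N | _) _; set c := \sum_(i < N | _) _.
  suff -> : a = b + c by ring.
  rewrite -big_split/=; apply: eq_bigr => i; rewrite -val_eqE/= neq_ltn => /orP[ik|ki].
    have iu : p i.+1 <= u by rewrite (le_trans _ ku)// partition_homo.
    have iu' : p i <= u by rewrite (le_trans _ iu)// partition_homo.
    rewrite /psum_term (clamp_le ut iu) (clamp_le ut iu') ltxx addr0 /clamp.
    by rewrite !(min_idPl _) ?(le_trans iu)// (le_trans iu').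
  have ui' : u <= p i.+1 by rewrite (le_trans (ltW uk))// partition_homo// leqW.
  have ui : u <= p i by rewrite (le_trans (ltW uk))// partition_homo.
  rewrite /psum_term (clamp_ge su ui) (clamp_ge su ui') ltxx add0r /clamp.
  by rewrite !(max_idPr _) ?le_min ?ut ?ui ?ui' ?(le_trans su)// le_min ut ?ui ?ui'.
pose x := clamp s t (p k); pose y := clamp s t (p k.+1).
have ex : x = clamp s u (p k).
  by rewrite /x /clamp !(min_idPl _)// (le_trans ku).
have ey : y = clamp u t (p k.+1).
  by rewrite /y /clamp !(max_idPr _)// le_min ?st ?ut ?(ltW uk)// (le_trans su)// ltW.
have cu : clamp s u (p k.+1) = u by rewrite clamp_ge// ltW.
have cu' : clamp u t (p k) = u by rewrite clamp_le.
have /andP[sx xu] := clamp_in (p k) su; rewrite -ex in sx xu.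
have /andP[uy yt] := clamp_in (p k.+1) ut; rewrite -ey in uy yt.
move: diff; rewrite /psum_term -/x -/y -ex -ey cu cu'.
move: xu uy; rewrite le_eqVlt => /orP[/eqP xu|xu].
  by rewrite xu ltxx => uy diff; left; rewrite diff; case: ifP => _; ring.
rewrite le_eqVlt => /orP[/eqP uy|uy].
  by rewrite -uy ltxx xu => diff; left; rewrite diff; ring.
rewrite xu uy (lt_trans xu uy) => diff; right; exists k, x, y.
split=> //; split=> //; split.
  by rewrite /x /clamp (min_idPl (le_trans ku ut)) le_max lexx orbT.
by rewrite ey /clamp ge_max (ltW uk) ge_min lexx.
Qed.

(** The last interval is set apart because a cadlag path oscillates little just
    before u, whereas it may jump at u. *)
Lemma psum_last s u : 0 <= s -> s < u ->
  exists k, exists x, [/\ s <= x, x < u, p k <= x, u <= p k.+1 &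
    forall r, psum p r s u = psum p r s x + r x u].
Proof.
move=> s0 su; have su' := ltW su.
have [N uN] := partition_exceeds u.
have [k /andP[ku uk]] := partition_bracketr (le_lt_trans s0 su).
have kN : (k < N)%N.
  by rewrite ltnNge; apply/negP => /partition_homo; rewrite leNgt (lt_le_trans ku).
pose x := clamp s u (p k).
have xE : x = Num.max s (p k) by rewrite /x /clamp (min_idPl (ltW ku)).
have sx : s <= x by rewrite xE le_max lexx.
have xu : x < u by rewrite xE gt_max su.
exists k, x; split=> // [|r].
  by rewrite xE le_max lexx orbT.
rewrite (psumE _ sx (le_trans (ltW xu) uN)) (psumE _ su' uN).
have D (f : nat -> R) :
    \sum_(i < N) f i = f k + \sum_(i < N | i != Ordinal kN) f i.
  by rewrite (bigD1 (Ordinal kN)).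
rewrite !D /psum_term -/x.
rewrite (clamp_ge su' uk) xu.
have -> : clamp s x (p k.+1) = x by rewrite clamp_ge// (le_trans (ltW xu)).
have -> : clamp s x (p k) = x.
  rewrite /clamp xE; case: (leP s (p k)) => spk.
    by rewrite minxx (max_idPr spk).
  by rewrite (min_idPl (ltW spk)) (max_idPl (ltW spk)).
rewrite ltxx add0r addrC; congr (_ + _).
apply: eq_bigr => i; rewrite -val_eqE/= neq_ltn => /orP[ik|ki].
  have pik : p i.+1 <= p k by rewrite partition_homo.
  have pii : p i <= p k by rewrite partition_homo// ltnW.
  have pkx : p k <= x by rewrite xE le_max lexx orbT.
  by rewrite /clamp !(min_idPl _)//; rewrite ?(le_trans pik) ?(le_trans pii)// ?ltW.
have upi : u <= p i by rewrite (le_trans uk)// partition_homo.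
have upi1 : u <= p i.+1 by rewrite (le_trans upi)// partition_homo.
rewrite (clamp_ge su' upi) (clamp_ge su' upi1) ltxx.
by rewrite !(clamp_ge sx) ?ltxx ?(le_trans (ltW xu)).
Qed.

End one_partition.

Lemma qv_sumE p X t : is_partition p -> 0 <= t ->
  qv_sum p X t = psum p (sq_incr X) 0 t.
Proof.
move=> pp t0; rewrite /qv_sum /psum; congr (limn (series _)); apply/funext => i.
have p0 j : 0 <= p j.
  by have [<- _ _] := pp; exact: partition_homo.
have cE j : clamp 0 t (p j) = Num.min (p j) t by rewrite /clamp (max_idPr _)// le_min p0.
rewrite /psum_term !cE /sq_incr; case: ifPn => //; rewrite -leNgt => le_.
suff -> : Num.min (p i.+1) t = Num.min (p i) t by rewrite subrr expr0n.
by apply/le_anti; rewrite le_ -!cE clamp_mono// partition_homo.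
Qed.

Lemma ito_sumE p (xi X : R -> R) t : is_partition p -> 0 <= t ->
  ito_sum p xi X t = psum p (fun x y => xi x * (X y - X x)) 0 t.
Proof.
move=> pp t0; rewrite /ito_sum /psum; congr (limn (series _)); apply/funext => i.
have p0 j : 0 <= p j.
  by have [<- _ _] := pp; exact: partition_homo.
have cE j : clamp 0 t (p j) = Num.min (p j) t by rewrite /clamp (max_idPr _)// le_min p0.
rewrite /psum_term !cE; case: ifPn => [lt_|]; last first.
  rewrite -leNgt => le_.
  suff -> : Num.min (p i.+1) t = Num.min (p i) t by rewrite subrr mulr0.
  by apply/le_anti; rewrite le_ -!cE clamp_mono// partition_homo.
suff -> : Num.min (p i) t = p i by [].
apply/min_idPl; rewrite leNgt; apply/negP => tp; move: lt_.
rewrite (min_idPr (ltW tp)) (min_idPr _) ?ltxx//.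
by rewrite (le_trans (ltW tp))// partition_homo.
Qed.

End partition_sums.
(** * Limits of partition sums along refining partitions *)

Section refining_partitions.
Context {R : realType}.
Variable Pi : nat -> nat -> R.
Hypothesis Pi_partition : forall n, is_partition (Pi n).
Hypothesis Pi_mesh : mesh (Pi n) @[n --> \oo] --> 0%E.
Implicit Types (r q m : R -> R -> R) (s t u x y : R).

Lemma mesh_small d : 0 < d ->
  \forall n \near \oo, forall i, Pi n i.+1 - Pi n i < d.
Proof.
move=> d0.
have : \forall n \near \oo, (mesh (Pi n) < d%:E)%E.
  suff /Pi_mesh : nbhs 0%E [set y : \bar R | (y < d%:E)%E] by [].
  by apply: open_ereal_lt'; rewrite lte_fin.
apply: filterS => n md i; rewrite -lte_fin; apply: le_lt_trans md.
apply: le_trans (ereal_sup_ubound _); last by exists i.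
by rewrite lee_fin ler_norm.
Qed.

(** The correction made in cutting a sum at u vanishes in the limit, for
    every u: see psum_split. *)
Definition near_additive r := forall u e, 0 <= u -> 0 < e ->
  exists2 d, 0 < d & forall x y, 0 <= x -> u - d < x < u -> u < y < u + d ->
    `|r x y - r x u - r u y| <= e.

(** At most one interval of each partition ends at or straddles a jump time u;
    this says that its contribution r x u is negligible. *)
Definition vanishes_left (T : R) r := forall u e, 0 < u -> u <= T -> 0 < e ->
  exists2 d, 0 < d & forall x, 0 <= x -> u - d < x < u -> `|r x u| <= e.

Lemma psum_near_additive r s u t e : near_additive r ->
  0 <= s -> s <= u -> u <= t -> 0 < e ->
  \forall n \near \oo,
    `|psum (Pi n) r s t - psum (Pi n) r s u - psum (Pi n) r u t| <= e.
Proof.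
move=> rad s0 su ut e0.
have [d d0 rd] := rad u e (le_trans s0 su) e0.
near=> n.
have nd : forall i, Pi n i.+1 - Pi n i < d by near: n; exact: mesh_small.
have [->|[k [x [y [[sx xu uy yt [kx yk]] ->]]]]] :=
    psum_split (Pi_partition n) r s0 su ut.
  by rewrite (_ : _ - _ - _ = 0) ?normr0 ?(ltW e0)//; ring.
have -> : forall a b c : R, a + b + c - a - b = c by move=> *; ring.
have {}nd := nd k.
by apply: rd; [exact: le_trans sx|apply/andP; split; lra..].
Unshelve. all: by end_near. Qed.

Lemma psum_last_near s u d : 0 <= s -> s < u -> 0 < d ->
  \forall n \near \oo, exists x, [/\ s <= x, u - d < x, x < u &
    forall r, psum (Pi n) r s u = psum (Pi n) r s x + r x u].
Proof.
move=> s0 su d0; near=> n.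
have nd : forall i, Pi n i.+1 - Pi n i < d by near: n; exact: mesh_small.
have [k [x [sx xu kx uk E]]] := psum_last (Pi_partition n) s0 su.
by exists x; split=> //; have := nd k; lra.
Unshelve. all: by end_near. Qed.

Lemma psumxx p r s : is_partition p -> psum p r s s = 0.
Proof.
move=> pp; have [N sN] := partition_exceeds pp s.
rewrite (psumE pp r (lexx s) sN) big1// => i _.
have cE z : clamp s s z = s by apply/le_anti; rewrite andbC clamp_in.
by rewrite /psum_term !cE ltxx.
Qed.

Lemma cvg_psum_increment T r (a : R -> R) : near_additive r ->
  (forall t, 0 <= t -> t <= T -> psum (Pi n) r 0 t @[n --> \oo] --> a t) ->
  forall s t, 0 <= s -> s <= t -> t <= T ->
    psum (Pi n) r s t @[n --> \oo] --> a t - a s.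
Proof.
move=> rad ra s t s0 st tT.
have -> : (fun n => psum (Pi n) r s t) = (fun n =>
    psum (Pi n) r 0 t - psum (Pi n) r 0 s -
    (psum (Pi n) r 0 t - psum (Pi n) r 0 s - psum (Pi n) r s t)).
  by apply/funext => n; ring.
have t0 := le_trans s0 st; have sT := le_trans st tT.
rewrite -[a t - a s]subr0; apply: cvgB; first by apply: cvgB; exact: ra.
by apply/cvgr0Pnorm_le => e e0; exact: psum_near_additive.
Qed.

(** The limit theorem behind both halves of the proof. Near each time u the
    functional r is a constant multiple of a functional q whose sums vanish, up
    to a small multiple of a functional m whose sums are bounded by the
    increments of M; the constant depends on u and on the side of u. Then the
    sums of r vanish. The typical case is r x y = V x * q x y for a cadlag V,
    with the constants V u and V_{u-}.

    The bound |sum of r up to t| <= eps * (M t - M 0) + o(1) is propagated by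
    real induction; eps is arbitrary. *)
Lemma psum_vanish T r q m (M : R -> R) :
  near_additive r -> vanishes_left T r -> vanishes_left T q ->
  (forall x y, 0 <= x -> x < y -> y <= T -> 0 <= m x y) ->
  (forall s t, 0 <= s -> s <= t -> t <= T ->
     psum (Pi n) q s t @[n --> \oo] --> 0) ->
  (forall s t e, 0 <= s -> s <= t -> t <= T -> 0 < e ->
     \forall n \near \oo, psum (Pi n) m s t <= M t - M s + e) ->
  (forall u e, 0 <= u -> u <= T -> 0 < e -> exists2 d, 0 < d & exists c,
     forall x y, u <= x -> x < y -> y < u + d -> y <= T ->
       `|r x y - c * q x y| <= e * m x y) ->
  (forall u e, 0 < u -> u <= T -> 0 < e -> exists2 d, 0 < d & exists c,
     forall x y, 0 <= x -> u - d < x -> x < y -> y < u ->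
       `|r x y - c * q x y| <= e * m x y) ->
  forall t, 0 <= t -> t <= T -> psum (Pi n) r 0 t @[n --> \oo] --> 0.
Proof.
move=> rad rl ql m0 q0 mM rright rleft.
have block c e' n s t : 0 < e' -> 0 <= s -> s <= t ->
    (forall x y, s <= x -> x < y -> y <= t -> 
       `|r x y - c * q x y| <= e' * m x y) ->
    `|psum (Pi n) r s t| <= `|c| * `|psum (Pi n) q s t| + e' * psum (Pi n) m s t.
  move=> e'0 s0 st H.
  have := psum_le (Pi_partition n) st H.
  have P := Pi_partition n.
  rewrite (psumB P) // !(psumZ P) // -normrM => H'.
  by rewrite -lerBlDl (le_trans _ H')// lerB_dist.
suff main eps : 0 < eps -> forall t, 0 <= t -> t <= T ->
    forall e, 0 < e -> \forall n \near \oo,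
      `|psum (Pi n) r 0 t| <= eps * (M t - M 0) + e.
  move=> t t0 tT; apply/cvgr0Pnorm_le => e e0.
  pose eps := e / 2 / (`|M t - M 0| + 1).
  have eps0 : 0 < eps by rewrite !divr_gt0// ltr_wpDl.
  have e20 : 0 < e / 2 by rewrite divr_gt0.
  have := main eps eps0 t t0 tT _ e20.
  apply: filterS => n /le_trans; apply.
  suff : eps * (M t - M 0) <= e / 2 by lra.
  apply: le_trans (ler_wpM2l (ltW eps0) (ler_norm _)) _.
  by rewrite mulrC mulr_div_succ_le// ltW.
move=> eps0; apply: (@real_induction _ (fun t => t <= T -> _)).
- move=> _ e e0; apply: nearW => n.
  by rewrite psumxx// normr0 subrr mulr0 add0r ltW.
- move=> u u0 IHu; have [uT|Tu] := leP u T; last first.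
    by exists 1 => // t /andP[ut _] tT; lra.
  have [d d0 [c cr]] := rright u eps u0 uT eps0.
  exists d => // t /andP[ut td] tT e e0; have ut' := ltW ut.
  have e40 : 0 < e / 4 by rewrite divr_gt0.
  have ce0 : 0 < e / 4 / (`|c| + 1) by rewrite divr_gt0// ltr_wpDl.
  have ee0 : 0 < e / 4 / eps by rewrite divr_gt0.
  have /cvgr0Pnorm_le/(_ _ ce0) Q := q0 u t u0 ut' tT.
  near=> n.
  have H1 : `|psum (Pi n) r 0 u| <= eps * (M u - M 0) + e / 4.
    by near: n; exact: IHu.
  have H2 : `|psum (Pi n) r 0 t - psum (Pi n) r 0 u - psum (Pi n) r u t| <= e / 4.
    by near: n; exact: psum_near_additive.
  have H3 : `|psum (Pi n) q u t| <= e / 4 / (`|c| + 1).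
    by near: n; exact: Q.
  have H4 : psum (Pi n) m u t <= M t - M u + e / 4 / eps.
    by near: n; exact: mM.
  have H5 := block c eps n u t eps0 u0 ut' (fun x y ux xy yt =>
    cr x y ux xy (le_lt_trans yt td) (le_trans yt tT)).
  have H6 : `|c| * `|psum (Pi n) q u t| <= e / 4.
    apply: le_trans (ler_wpM2l _ H3) _ => //.
    by apply: mulr_div_succ_le => //; exact: ltW.
  have H7 : eps * psum (Pi n) m u t <= eps * (M t - M u) + e / 4.
    apply: le_trans (ler_wpM2l (ltW eps0) H4) _.
    by rewrite mulrDr lerD2l mulrC divfK// gt_eqF.
  have -> : psum (Pi n) r 0 t = psum (Pi n) r 0 u + psum (Pi n) r u t +
    (psum (Pi n) r 0 t - psum (Pi n) r 0 u - psum (Pi n) r u t) by ring.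
  apply: le_trans (ler_normD _ _) _.
  have := ler_normD (psum (Pi n) r 0 u) (psum (Pi n) r u t).
  have -> : eps * (M t - M 0) = eps * (M t - M u) + eps * (M u - M 0) by ring.
  lra.
- move=> u u0 IHu uT e e0.
  have [d d0 [c cr]] := rleft u eps u0 uT eps0.
  have [s [s0 sd su]] := left_approach u0 d0.
  have e80 : 0 < e / 8 by rewrite divr_gt0.
  have ce0 : 0 < e / 8 / (`|c| + 1) by rewrite divr_gt0// ltr_wpDl.
  have ee0 : 0 < e / 8 / eps by rewrite divr_gt0.
  have /cvgr0Pnorm_le/(_ _ ce0) Q := q0 s u s0 (ltW su) uT.
  have [d1 d10 rd1] := rl u _ u0 uT e80.
  have [d2 d20 qd2] := ql u _ u0 uT ce0.
  have d120 : 0 < Num.min d1 d2 by rewrite lt_min d10.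
  near=> n.
  have H1 : `|psum (Pi n) r 0 s| <= eps * (M s - M 0) + e / 8.
    by near: n; apply: IHu => //; [rewrite s0|lra].
  have H2 : `|psum (Pi n) r 0 u - psum (Pi n) r 0 s - psum (Pi n) r s u| <= e / 8.
    by near: n; apply: psum_near_additive => //; exact: ltW.
  have H3 : `|psum (Pi n) q s u| <= e / 8 / (`|c| + 1).
    by near: n; exact: Q.
  have H4 : psum (Pi n) m s u <= M u - M s + e / 8 / eps.
    by near: n; apply: mM => //; exact: ltW.
  have [x [sx ux xu split]] : exists x, [/\ s <= x, u - Num.min d1 d2 < x, x < u &
      forall r, psum (Pi n) r s u = psum (Pi n) r s x + r x u].
    by near: n; exact: psum_last_near.
  have x0 := le_trans s0 sx.
  have H8 : `|r x u| <= e / 8.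
    apply: rd1 => //; rewrite xu andbT (le_lt_trans _ ux)//.
    by rewrite lerB// ge_min lexx.
  have H9 : `|q x u| <= e / 8 / (`|c| + 1).
    apply: qd2 => //; rewrite xu andbT (le_lt_trans _ ux)//.
    by rewrite lerB// ge_min lexx orbT.
  have H5 := block c eps n s x eps0 s0 sx (fun a b sa ab bx =>
    cr a b (le_trans s0 sa) (lt_le_trans sd sa) ab (le_lt_trans bx xu)).
  have H3' : `|psum (Pi n) q s x| <= e / 8 / (`|c| + 1) + e / 8 / (`|c| + 1).
    have -> : psum (Pi n) q s x = psum (Pi n) q s u - q x u by rewrite split addrK.
    by rewrite (le_trans (ler_normB _ _))// lerD.
  have H6 : `|c| * `|psum (Pi n) q s x| <= e / 4.
    apply: le_trans (ler_wpM2l _ H3') _ => //.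
    have : `|c| * (e / 8 / (`|c| + 1)) <= e / 8.
      by apply: mulr_div_succ_le => //; exact: ltW.
    lra.
  have H4' : psum (Pi n) m s x <= psum (Pi n) m s u.
    by rewrite split lerDl m0.
  have H7 : eps * psum (Pi n) m s x <= eps * (M u - M s) + e / 8.
    apply: le_trans (ler_wpM2l (ltW eps0) (le_trans H4' H4)) _.
    by rewrite mulrDr lerD2l mulrC divfK// gt_eqF.
  have -> : psum (Pi n) r 0 u = psum (Pi n) r 0 s + psum (Pi n) r s x + r x u +
    (psum (Pi n) r 0 u - psum (Pi n) r 0 s - psum (Pi n) r s u).
    by rewrite split; ring.
  apply: le_trans (ler_normD _ _) _.
  have := ler_normD (psum (Pi n) r 0 s + psum (Pi n) r s x) (r x u).
  have := ler_normD (psum (Pi n) r 0 s) (psum (Pi n) r s x).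
  have -> : eps * (M u - M 0) = eps * (M u - M s) + eps * (M s - M 0) by ring.
  lra.
Unshelve. all: by end_near. Qed.

End refining_partitions.
(** * Interval functionals of cadlag paths *)

Section left_germs.
Context {R : realType}.
Implicit Types (r : R -> R -> R) (X Y : R -> R) (T u : R).

Lemma cvg_to0 {S : Type} {F : set_system S} {FF : Filter F} (g : S -> R) (l : R)
    (f : S -> R) : f =1 g -> l = 0 -> g @ F --> l -> f @ F --> 0.
Proof. by move=> /funext -> ->. Qed.

Lemma cadlag_cvg_left X u : cadlag X -> 0 < u ->
  X x @[x --> u^'-] --> left_lim X u.
Proof. by move=> [_ Xl] u0; rewrite /left_lim leNgt u0/=; exact: Xl. Qed.

Lemma cadlag_cvg_fst X u : cadlag X -> 0 < u ->
  X z.1 @[z --> (u^'-, u^'+)] --> left_lim X u.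
Proof. by move=> Xc u0; apply: cvg_comp (cadlag_cvg_left Xc u0); exact: cvg_fst. Qed.

Lemma cadlag_cvg_snd X u : cadlag X -> 0 < u ->
  X z.2 @[z --> (u^'-, u^'+)] --> X u.
Proof. 
move=> [Xr _] u0; apply: cvg_comp (Xr u (ltW u0)); exact: cvg_snd.
Qed.

(** On the left of u only left limits matter and on the right only the value
    at u, so the correction can be computed by the algebra of limits. *)
Lemma cvg_near_additive r :
  (forall u, 0 < u ->
     (r z.1 z.2 - r z.1 u - r u z.2) @[z --> (u^'-, u^'+)] --> 0) ->
  near_additive r.
Proof.
move=> rc u e u0 e0; move: u0; rewrite le_eqVlt => /orP[/eqP <-|u0].
  by exists 1 => // x y x0 /andP[_ /lt_le_trans/(_ x0)]; rewrite ltxx.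
have /cvgr0Pnorm_le/(_ e e0)[[A B] /= [/near_leftP[d1 d10 dA] /near_rightP[d2 d20 dB]] AB] :=
  rc u u0.
exists (Num.min d1 d2); first by rewrite lt_min d10.
move=> x y x0 /andP[ux xu] /andP[uy yu]; apply: (AB (x, y)); split => /=.
- by apply: dA; rewrite xu (le_lt_trans _ ux)// lerB// ge_min lexx.
- by apply: dB; rewrite uy (lt_le_trans yu)// lerD// ge_min lexx orbT.
Qed.

Lemma cvg_vanishes_left T r :
  (forall u, 0 < u -> u <= T -> r x u @[x --> u^'-] --> 0) ->
  vanishes_left T r.
Proof.
move=> rc u e u0 uT e0.
have /cvgr0Pnorm_le/(_ e e0)/near_leftP[d d0 rd] := rc u u0 uT.
by exists d => // x _; exact: rd.
Qed.

(** The correction is the double product 2 (X y - X u) (X u - X x). *)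
Lemma near_additive_sq X : cadlag X -> near_additive (sq_incr X).
Proof.
move=> Xc; apply: cvg_near_additive => u u0.
have Xl := cadlag_cvg_fst Xc u0; have Xr := cadlag_cvg_snd Xc u0.
apply: (@cvg_to0 _ _ _ (fun z => 2 * (X z.2 - X u) * (X u - X z.1))
  (2 * (X u - X u) * (X u - left_lim X u))); [move=> z; rewrite /sq_incr; ring|ring|].
by apply: cvgM; [apply: cvgMr; apply: cvgB => //; exact: cvg_cst|
  apply: cvgB => //; exact: cvg_cst].
Qed.

(** The correction is (Y u - Y x) (X y - X u). *)
Lemma near_additive_linear_error X Y : cadlag X -> cadlag Y ->
  near_additive (linear_error X Y).
Proof.
move=> Xc Yc; apply: cvg_near_additive => u u0.
have Xr := cadlag_cvg_snd Xc u0; have Yl := cadlag_cvg_fst Yc u0.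
apply: (@cvg_to0 _ _ _ (fun z => (Y u - Y z.1) * (X z.2 - X u))
  ((Y u - left_lim Y u) * (X u - X u))); [move=> z; rewrite /linear_error; ring|ring|].
by apply: cvgM; apply: cvgB => //; exact: cvg_cst.
Qed.

(** The weight is taken at the right endpoint, as the product rule used in
    solution_eq0 requires. *)
Lemma near_additive_weighted V X Y : cadlag V -> cadlag X -> cadlag Y ->
  near_additive (fun x y => V y * linear_error X Y x y).
Proof.
move=> Vc Xc Yc; apply: cvg_near_additive => u u0.
have Xr := cadlag_cvg_snd Xc u0; have Yl := cadlag_cvg_fst Yc u0.
have Xl := cadlag_cvg_fst Xc u0; have Vr := cadlag_cvg_snd Vc u0.
apply: (@cvg_to0 _ _ _ (fun z => V z.2 * ((Y u - Y z.1) * (X z.2 - X u)) +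
    (V z.2 - V u) * (Y u - Y z.1 - Y z.1 * (X u - X z.1)))
  (V u * ((Y u - left_lim Y u) * (X u - X u)) +
    (V u - V u) * (Y u - left_lim Y u - left_lim Y u * (X u - left_lim X u)))).
- by move=> z; rewrite /linear_error; ring.
- by ring.
have c (a : R) : a @[_ --> (u^'-, u^'+)] --> a by exact: cvg_cst.
apply: cvgD; apply: cvgM.
- exact: Vr.
- by apply: cvgM; apply: cvgB.
- by apply: cvgB.
- by apply: cvgB; [|apply: cvgM => //]; apply: cvgB.
Qed.

Lemma cadlag_right_osc X u e : cadlag X -> 0 <= u -> 0 < e ->
  exists2 d, 0 < d & forall x y, u <= x < u + d -> u <= y < u + d ->
    `|X y - X x| <= e.
Proof.
move=> Xc u0 e0; have e20 : 0 < e / 2 by rewrite divr_gt0.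
have [d d0 dX] := cadlag_right Xc u0 e20.
exists d => // x y /dX; rewrite distrC => Hx /dX Hy.
rewrite (_ : X y - X x = (X y - X u) + (X u - X x)); last by ring.
apply: le_trans (ler_normD _ _) _; lra.
Qed.

Lemma cadlag_left_osc X u e : cadlag X -> 0 < u -> 0 < e ->
  exists2 d, 0 < d & forall x y, u - d < x < u -> u - d < y < u ->
    `|X y - X x| <= e.
Proof.
move=> Xc u0 e0; have e20 : 0 < e / 2 by rewrite divr_gt0.
have [d d0 dX] := cadlag_left Xc u0 e20.
exists d => // x y /dX; rewrite distrC => Hx /dX Hy.
rewrite (_ : X y - X x = (X y - left_lim X u) + (left_lim X u - X x)); last by ring.
apply: le_trans (ler_normD _ _) _; lra.
Qed.

End left_germs.

(** * Euler errors of solutions *)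

Section quadratic_variation.
Context {R : realType}.
Variables (Pi : nat -> nat -> R) (X : R -> R).
Hypothesis Pi_partition : forall n, is_partition (Pi n).
Hypothesis Pi_mesh : mesh (Pi n) @[n --> \oo] --> 0%E.
Hypothesis X_QV : QV Pi X.
Implicit Types (Y D N : R -> R) (T s t u x y : R).

Let Q := qv Pi X.
Let Xc : cadlag X. Proof. by case: X_QV. Qed.
Let Qc : cadlag Q. Proof. by case: X_QV. Qed.

Lemma qv_homo s t : 0 <= s -> s <= t -> Q s <= Q t.
Proof.
move=> s0 st; have [_ _ _ Qm _] := X_QV.
by apply: Qm => //; rewrite in_itv/= ?s0 ?(le_trans s0 st).
Qed.

Lemma qv_jump u : 0 < u -> Q u - left_lim Q u = (X u - left_lim X u) ^+ 2.
Proof. by move=> u0; have [_ _ _ _ /(_ u (ltW u0))] := X_QV. Qed.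

Lemma cvg_psum_sq s t : 0 <= s -> s <= t ->
  psum (Pi n) (sq_incr X) s t @[n --> \oo] --> Q t - Q s.
Proof.
move=> s0 st; apply: (cvg_psum_increment (T := t) Pi_partition Pi_mesh) => //.
  exact: near_additive_sq.
move=> u u0 _; have [_ Xcv _ _ _] := X_QV.
have -> : (fun n => psum (Pi n) (sq_incr X) 0 u) = (fun n => qv_sum (Pi n) X u).
  by apply/funext => n; rewrite qv_sumE.
exact: Xcv.
Qed.

Lemma psum_sq_le s t e : 0 <= s -> s <= t -> 0 < e ->
  \forall n \near \oo, psum (Pi n) (sq_incr X) s t <= Q t - Q s + e.
Proof.
move=> s0 st e0; have := cvg_psum_sq s0 st.
move=> /cvgrPdist_le/(_ e e0); apply: filterS => n.
by rewrite ler_norml => /andP[]; lra.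
Qed.

(** This is the condition that the jump of [X, X] is the squared jump of X. *)
Lemma sq_qv_vanishes_left T :
  vanishes_left T (fun x y => sq_incr X x y - (Q y - Q x)).
Proof.
apply: cvg_vanishes_left => u u0 _.
apply: (@cvg_to0 _ _ _ _ (fun x => (X u - X x) * (X u - X x) - (Q u - Q x))
  ((X u - left_lim X u) * (X u - left_lim X u) - (Q u - left_lim Q u))).
- by move=> x; rewrite /sq_incr expr2.
- by rewrite qv_jump// expr2 subrr.
have Xl := cadlag_cvg_left Xc u0; have Ql := cadlag_cvg_left Qc u0.
have c (a : R) : a @[_ --> u^'-] --> a by exact: cvg_cst.
by apply: cvgB; [apply: cvgM|]; apply: cvgB.
Qed.

(** Euler errors are of second order: they are dominated by the increments of
    an increasing function and by squared increments of X. *)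
Definition controlled Y T := exists N, exists2 C, 0 <= C &
  (forall s t, 0 <= s -> s <= t -> t <= T -> N s <= N t) /\
  (forall s t, 0 <= s -> s <= t -> t <= T ->
     `|linear_error X Y s t| <= N t - N s + C * sq_incr X s t).

(** The equation on [0, T], in terms of Euler errors; see linear_error. *)
Definition solves Y T := forall t, 0 <= t -> t <= T ->
  psum (Pi n) (linear_error X Y) 0 t @[n --> \oo] --> 0.

Lemma solvesB Y1 Y2 T : solves Y1 T -> solves Y2 T ->
  solves (fun t => Y1 t - Y2 t) T.
Proof.
move=> s1 s2 t t0 tT; 
apply: (@cvg_to0 _ _ _ _ (fun n => psum (Pi n) (linear_error X Y1) 0 t -
  psum (Pi n) (linear_error X Y2) 0 t) (0 - 0)); last 2 first.
- by rewrite subr0.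
- by apply: cvgB; [exact: s1|exact: s2].
move=> n; rewrite -(psumB (Pi_partition n)) //; apply: eq_psum => // x y _ _ _.
by rewrite /linear_error; ring.
Qed.

Lemma controlledB Y1 Y2 T : controlled Y1 T -> controlled Y2 T ->
  controlled (fun t => Y1 t - Y2 t) T.
Proof.
move=> [N1 [C1 C10 [m1 H1]]] [N2 [C2 C20 [m2 H2]]].
exists (fun t => N1 t + N2 t), (C1 + C2); first by rewrite addr_ge0.
split=> [s t s0 st tT|s t s0 st tT]; first by rewrite lerD ?m1 ?m2.
rewrite (_ : linear_error X _ s t = linear_error X Y1 s t - linear_error X Y2 s t);
  last by rewrite /linear_error; ring.
have := ler_normB (linear_error X Y1 s t) (linear_error X Y2 s t).
have := H1 s t s0 st tT; have := H2 s t s0 st tT; lra.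
Qed.

Lemma solves_psum Y T s t : cadlag Y -> solves Y T ->
  0 <= s -> s <= t -> t <= T ->
  psum (Pi n) (linear_error X Y) s t @[n --> \oo] --> 0.
Proof.
move=> Yc Ys s0 st tT; have rad := near_additive_linear_error Xc Yc.
have := cvg_psum_increment Pi_partition Pi_mesh rad Ys s0 st tT.
by rewrite subrr.
Qed.

(** If dg = Y dX up to second order and dY = Y dX exactly, then Y - g has
    increments of second order, hence so has dY - Y dX. In the application
    Y = f_x(A, X) and g = f(A, X). *)
Lemma controlled_of_primitive Y g N C T : cadlag Y -> solves Y T -> 0 <= C ->
  (forall s t, 0 <= s -> s <= t -> t <= T -> N s <= N t) ->
  (forall s t, 0 <= s -> s <= t -> t <= T ->
     `|g t - g s - Y s * (X t - X s)| <= N t - N s + C * sq_incr X s t) ->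
  controlled Y T.
Proof.
move=> Yc Ys C0 Nm Ng.
exists (fun t => 2 * N t + C * Q t), C => //; split=> [s t s0 st tT|s t s0 st tT].
  by rewrite lerD// ler_wpM2l// ?Nm// qv_homo.
have H1 := Ng s t s0 st tT.
suff H2 : `|(Y t - Y s) - (g t - g s)| <= N t - N s + C * (Q t - Q s).
  rewrite (_ : linear_error X Y s t = ((Y t - Y s) - (g t - g s)) +
    (g t - g s - Y s * (X t - X s))); last by rewrite /linear_error; ring.
  apply: le_trans (ler_normD _ _) _; lra.
apply/ler_addgt0Pr => e e0; have e20 : 0 < e / 2 by rewrite divr_gt0.
have /cvgr0Pnorm_le/(_ _ e20) Rs := solves_psum Yc Ys s0 st tT.
have eC0 : 0 < e / 2 / (C + 1) by rewrite divr_gt0// ltr_wpDl.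
have qs := psum_sq_le s0 st eC0.
near \oo => n; have P := Pi_partition n.
have hR : `|psum (Pi n) (linear_error X Y) s t| <= e / 2 by near: n.
have hq : psum (Pi n) (sq_incr X) s t <= Q t - Q s + e / 2 / (C + 1) by near: n.
have hg : `|psum (Pi n) (fun x y => g y - g x - Y x * (X y - X x)) s t| <=
    psum (Pi n) (fun x y => (N y - N x) + C * sq_incr X x y) s t.
  apply: psum_le => // x y sx xy yt.
  by apply: Ng; [exact: le_trans sx|exact: ltW|exact: le_trans tT].
rewrite psumD// psumZ// psum_telescope// in hg.
have e1 : psum (Pi n) (fun x y => g y - g x - Y x * (X y - X x)) s t =
    (g t - g s) - (Y t - Y s) + psum (Pi n) (linear_error X Y) s t.
  rewrite -(psum_telescope P g s0 st) -(psum_telescope P Y s0 st).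
  rewrite -psumB// -psumD//; apply: eq_psum => // x y _ _ _.
  by rewrite /linear_error; ring.
rewrite e1 in hg.
have hC : C * psum (Pi n) (sq_incr X) s t <= C * (Q t - Q s) + e / 2.
  apply: le_trans (ler_wpM2l C0 hq) _; rewrite mulrDr lerD2l.
  by rewrite mulr_div_succ_le// ltW.
rewrite (_ : Y t - Y s - (g t - g s) = psum (Pi n) (linear_error X Y) s t -
  ((g t - g s) - (Y t - Y s) + psum (Pi n) (linear_error X Y) s t)); last by ring.
apply: le_trans (ler_normB _ _) _; lra.
Unshelve. all: by end_near. Qed.

(** A monotone function has left limits: N s is close to the supremum of its
    values before u, for s close to u. *)
Lemma monotone_left_osc N T u e :
  (forall s t, 0 <= s -> s <= t -> t <= T -> N s <= N t) ->
  0 < u -> u <= T -> 0 < e ->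
  exists2 d, 0 < d & forall x y, 0 <= x -> u - d < x -> x <= y -> y < u ->
    N y - N x <= e.
Proof.
move=> Nm u0 uT e0.
pose E := [set N x | x in [set x | 0 <= x < u]].
have E0 : has_sup E.
  split; first by exists (N 0), 0 => //=; rewrite lexx.
  by exists (N u) => _ [x /andP[x0 xu] <-]; apply: Nm => //; exact: ltW.
have [_ [x /andP[x0 xu] <-] xe] := sup_adherent e0 E0.
exists (u - x); first by rewrite subr_gt0.
move=> a b a0 xa ab bu.
have Na : N x <= N a by apply: Nm => //; lra.
have Nb : N b <= sup E.
  apply: (ub_le_sup (proj2 E0)); exists b => //=.
  by rewrite bu (le_trans a0).
lra.
Qed.

(** A solution satisfies Y_u - Y_{u-} = Y_{u-} (X_u - X_{u-}): the left limit l
    of linear_error X Y x u as x increases to u is 0. Indeed the Euler errors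
    over [s, u] sum to nearly 0, the last one is close to l, and the others
    are bounded by the increments over [s, u[ of an increasing function and of
    [X, X], which are small since the jump of [X, X] at u is already
    accounted for by the squared jump of X. *)
Lemma solution_jump Y T : cadlag Y -> solves Y T -> controlled Y T ->
  vanishes_left T (linear_error X Y).
Proof.
move=> Yc Ys [N [C C0 [Nm YN]]]; apply: cvg_vanishes_left => u u0 uT.
have Xl := cadlag_cvg_left Xc u0; have Yl := cadlag_cvg_left Yc u0.
have Ql := cadlag_cvg_left Qc u0.
have c (a : R) : a @[_ --> u^'-] --> a by exact: cvg_cst.
pose l := Y u - left_lim Y u - left_lim Y u * (X u - left_lim X u).
have Rl : linear_error X Y x u @[x --> u^'-] --> l.
  by rewrite /linear_error; apply: cvgB; [|apply: cvgM => //]; apply: cvgB.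
suff -> : 0 = l by [].
apply/esym/eqP; rewrite -normr_le0; apply/ler_addgt0Pr => e' e'0; rewrite add0r.
pose e := e' / (4 * C + 4).
have C4 : 0 < 4 * C + 4 by lra.
have e0 : 0 < e by rewrite divr_gt0.
suff : `|l| <= (4 * C + 4) * e by rewrite /e mulrC divfK// gt_eqF.
have /cvgrPdist_le/(_ e e0)/near_leftP[d1 d10 dR] := Rl.
have /cvgrPdist_le/(_ e e0)/near_leftP[d2 d20 dQ] := Ql.
have [d3 d30 dN] := monotone_left_osc Nm u0 uT e0.
have [d4 d40 dS] := sq_qv_vanishes_left u0 (lexx u) e0.
pose d := Num.min (Num.min d1 d2) (Num.min d3 d4).
have d0 : 0 < d by rewrite !lt_min d10 d20 d30 d40.
have [dd1 dd2 dd3 dd4] : [/\ d <= d1, d <= d2, d <= d3 & d <= d4].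
  by rewrite /d !ge_min !lexx !orbT.
have [s [s0 sd su]] := left_approach u0 d0.
have /cvgr0Pnorm_le/(_ _ e0) Rs := solves_psum Yc Ys s0 (ltW su) uT.
have qs := psum_sq_le s0 (ltW su) e0.
near \oo => n; have P := Pi_partition n.
have hR : `|psum (Pi n) (linear_error X Y) s u| <= e by near: n.
have hq : psum (Pi n) (sq_incr X) s u <= Q u - Q s + e by near: n.
have [x [sx ux xu split]] : exists x, [/\ s <= x, u - d < x, x < u &
      forall r, psum (Pi n) r s u = psum (Pi n) r s x + r x u].
  by near: n; exact: psum_last_near.
have xT : x <= T by rewrite (le_trans (ltW xu)).
have hg : `|psum (Pi n) (linear_error X Y) s x| <=
    psum (Pi n) (fun x y => (N y - N x) + C * sq_incr X x y) s x.
  apply: psum_le => // a b sa ab bx.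
  by apply: YN; [exact: le_trans sa|exact: ltW|exact: le_trans xT].
rewrite psumD// psumZ// psum_telescope// in hg.
have sub r z : d <= r -> u - d < z -> z < u -> u - r < z < u.
  by move=> dr dz zu; rewrite zu (le_lt_trans _ dz)// lerB.
have hN : N x - N s <= e.
  by apply: dN => //; case/andP: (sub _ _ dd3 sd su).
(* The last point x of the partition before u is as close to u as s is. *)
have hRx : `|l - linear_error X Y x u| <= e by apply: dR; exact: sub.
have hS : `|sq_incr X x u - (Q u - Q x)| <= e.
  by apply: dS; [exact: le_trans sx|exact: sub].
have hQs : `|left_lim Q u - Q s| <= e by apply: dQ; exact: sub.
have hQx : `|left_lim Q u - Q x| <= e by apply: dQ; exact: sub.
rewrite split in hR; rewrite split in hq.
have Qsx : Q s <= Q x by exact: qv_homo.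
have hsq : psum (Pi n) (sq_incr X) s x <= 4 * e.
  by move: hS hQs hQx; rewrite !ler_norml => /andP[? ?] /andP[? ?] /andP[? ?]; lra.
have hC := ler_wpM2l C0 hsq.
rewrite (_ : l = (l - linear_error X Y x u) +
  ((psum (Pi n) (linear_error X Y) s x + linear_error X Y x u) -
   psum (Pi n) (linear_error X Y) s x)); last by ring.
apply: le_trans (ler_normD _ _) _.
have := ler_normB (psum (Pi n) (linear_error X Y) s x + linear_error X Y x u)
  (psum (Pi n) (linear_error X Y) s x).
lra.
Unshelve. all: by end_near. Qed.


End quadratic_variation.
(** * Uniqueness for homogeneous equations with zero initial value *)

Section cadlag_algebra.
Context {R : realType}.
Implicit Types X Y : R -> R.

Lemma cadlagM X Y : cadlag X -> cadlag Y -> cadlag (fun t => X t * Y t).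
Proof.
move=> [Xr Xl] [Yr Yl]; split=> t t0; first by apply: cvgM; [exact: Xr|exact: Yr].
by apply: is_cvgM; [exact: Xl|exact: Yl].
Qed.

Lemma cadlagB X Y : cadlag X -> cadlag Y -> cadlag (fun t => X t - Y t).
Proof.
move=> [Xr Xl] [Yr Yl]; split=> t t0; first by apply: cvgB; [exact: Xr|exact: Yr].
by apply: is_cvgB; [exact: Xl|exact: Yl].
Qed.

Lemma cadlag_cst (c : R) : cadlag (fun=> c).
Proof. by split=> t _; [exact: cvg_cst|exact: is_cvg_cst]. Qed.

Lemma cadlag_expR X : cadlag X -> cadlag (fun t => expR (X t)).
Proof.
move=> [Xr Xl]; split=> t t0.
  by apply: continuous_cvg; [exact: continuous_expR|exact: Xr].
apply/cvg_ex; exists (expR (lim (X s @[s --> t^'-]))).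
by apply: continuous_cvg; [exact: continuous_expR|exact: Xl].
Qed.

(** The product rule for exp(- X) and Y leaves this factor on an interval over
    which X increases by x. *)
Lemma expR_jump_bound (x : R) : `|x| <= 1 ->
  `|1 - (1 + x) * expR (- x)| <= x ^+ 2.
Proof.
rewrite ler_norml => /andP[x1 x2].
have h1 : (1 + x) * expR (- x) <= 1.
  rewrite -[leRHS](expRxMexpNx_1 x) ler_pM2r ?expR_gt0//; exact: expR_ge1Dx.
have h2 : (1 + x) * (1 - x) <= (1 + x) * expR (- x).
  by apply: ler_wpM2l; [lra|exact: expR_ge1Dx].
by rewrite ger0_norm; nra.
Qed.

End cadlag_algebra.

Section uniqueness.
Context {R : realType}.
Variables (Pi : nat -> nat -> R) (X : R -> R).
Hypothesis Pi_partition : forall n, is_partition (Pi n).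
Hypothesis Pi_mesh : mesh (Pi n) @[n --> \oo] --> 0%E.
Hypothesis X_QV : QV Pi X.
Implicit Types (V Y D N : R -> R) (T s t u x y : R).

Let Q := qv Pi X.
Let Xc : cadlag X. Proof. by case: X_QV. Qed.
Let Qc : cadlag Q. Proof. by case: X_QV. Qed.

Lemma psum_controlled_le D T : controlled X D T -> exists M : R -> R,
  forall s t e, 0 <= s -> s <= t -> t <= T -> 0 < e ->
    \forall n \near \oo,
      psum (Pi n) (fun x y => `|linear_error X D x y|) s t <= M t - M s + e.
Proof.
move=> [N [C C0 [Nm DN]]]; exists (fun t => N t + C * Q t) => s t e s0 st tT e0.
have eC0 : 0 < e / (C + 1) by rewrite divr_gt0// ltr_wpDl.
have qs := psum_sq_le Pi_partition Pi_mesh X_QV s0 st eC0.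
near=> n; have P := Pi_partition n.
have hq : psum (Pi n) (sq_incr X) s t <= Q t - Q s + e / (C + 1) by near: n.
have h : `|psum (Pi n) (fun x y => `|linear_error X D x y|) s t| <=
    psum (Pi n) (fun x y => (N y - N x) + C * sq_incr X x y) s t.
  apply: psum_le => // x y sx xy yt; rewrite normr_id.
  by apply: DN; [exact: le_trans sx|exact: ltW|exact: le_trans tT].
rewrite psumD// psumZ// psum_telescope// in h.
have hC := ler_wpM2l C0 hq.
have := mulr_div_succ_le C0 (ltW e0).
have := ler_norm (psum (Pi n) (fun x y => `|linear_error X D x y|) s t).
lra.
Unshelve. all: by end_near. Qed.

(** Associativity of the integral in disguise: if dY = Y dX then
    V dY = V Y dX, for every cadlag weight V. *)
Lemma psum_weighted V D T : cadlag V -> cadlag D ->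
  solves Pi X D T -> controlled X D T ->
  forall s t, 0 <= s -> s <= t -> t <= T ->
    psum (Pi n) (fun x y => V y * linear_error X D x y) s t @[n --> \oo] --> 0.
Proof.
move=> Vc Dc Ds Dcon.
have rad := near_additive_weighted Vc Xc Dc.
have Rl : vanishes_left T (linear_error X D).
  exact: (solution_jump Pi_partition Pi_mesh X_QV).
have [M MD] := psum_controlled_le Dcon.
move=> s t s0 st tT; rewrite -[X in _ --> X](subrr (0 : R)).
apply: (cvg_psum_increment (a := fun=> 0) Pi_partition Pi_mesh rad _ s0 st tT)
  => {s t s0 st tT}.
(* The errors are weighted by V u on the right of u and by V_{u-} on the left. *)
apply: (@psum_vanish _ _ Pi_partition Pi_mesh T _ (linear_error X D)
  (fun x y => `|linear_error X D x y|) M) => //.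
- move=> u e u0 uT e0.
  have eV : 0 < e / (`|V u| + 1) by rewrite divr_gt0// ltr_wpDl.
  have [d d0 Rd] := Rl u _ u0 uT eV.
  exists d => // x x0 /(Rd _ x0) h; rewrite normrM.
  apply: le_trans (ler_wpM2l _ h) _ => //.
  by rewrite mulr_div_succ_le// ltW.
- by move=> s t s0 st tT; apply: (solves_psum Pi_partition Pi_mesh X_QV Dc Ds s0 st tT).
- move=> u e u0 uT e0; have [d d0 Vd] := cadlag_right_osc Vc u0 e0.
  exists d => //; exists (V u) => x y ux xy yd _.
  rewrite -mulrBl normrM ler_wpM2r// Vd ?lexx ?ltrDl//.
  by rewrite yd (le_trans ux)// ltW.
- move=> u e u0 uT e0; have [d d0 Vd] := cadlag_left Vc u0 e0.
  exists d => //; exists (left_lim V u) => x y x0 ux xy yu.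
  by rewrite -mulrBl normrM ler_wpM2r// Vd// yu (lt_trans ux).
Qed.

(** With V = exp(- X) and G = V D, the product rule reads
    G_y - G_x = V_y R(x, y) - G_x phi(X_y - X_x), where R is the Euler error of
    D and phi(z) = 1 - (1 + z) exp(- z) is at most z ^+ 2 for |z| <= 1. The first
    terms sum to 0, so |G_t - G_u| <= sup |G| ([X, X]_t - [X, X]_u), and G
    vanishes just after each zero u. At a left limit of zeros, D vanishes by
    solution_jump. *)
Lemma solution_eq0 D T : cadlag D -> D 0 = 0 ->
  solves Pi X D T -> controlled X D T ->
  forall t, 0 <= t -> t <= T -> D t = 0.
Proof.
move=> Dc D0 Ds Dcon.
pose V t := expR (- X t); pose G t := V t * D t.
have Vc : cadlag V.
  apply: cadlag_expR; have := cadlagB (cadlag_cst 0) Xc.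
  by congr cadlag; apply/funext => t; rewrite sub0r.
have Gc : cadlag G by exact: cadlagM.
have Dl : vanishes_left T (linear_error X D).
  exact: (solution_jump Pi_partition Pi_mesh X_QV).
apply: (@real_induction _ (fun t => t <= T -> D t = 0)) => //.
- move=> u u0 IHu; have [uT|Tu] := leP u T; last first.
    by exists 1 => // t /andP[ut _] tT; lra.
  have Du := IHu uT.
  have [d1 d10 Xd] := cadlag_right_osc Xc u0 ltr01.
  have h0 : 0 < 2^-1 :> R by rewrite invr_gt0.
  have [d2 d20 Qd] := cadlag_right Qc u0 h0.
  have [d3 d30 Gd] := cadlag_right Gc u0 ltr01.
  have Gu : G u = 0 by rewrite /G Du mulr0.
  pose d := Num.min (Num.min d1 d2) d3.
  have [dd1 dd2 dd3] : [/\ d <= d1, d <= d2 & d <= d3].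
    by rewrite /d !ge_min !lexx !orbT.
  have d0 : 0 < d by rewrite !lt_min d10 d20 d30.
  pose E := [set `|G t| | t in [set t | u <= t < u + d /\ t <= T]].
  have EG t : u <= t -> t < u + d -> t <= T -> `|G t| <= sup E.
    move=> ut td tT; apply: ub_le_sup; last by exists t => //; split=> //; rewrite ut.
    exists 1 => _ [x [/andP[ux xd] xT] <-].
    by have := Gd x; rewrite Gu subr0; apply; apply/andP; split => //; lra.
  have E0 : E !=set0 by exists `|G u|, u => //; split=> //; rewrite lexx ltrDl.
  have supE0 : 0 <= sup E.
    by rewrite (le_trans _ (EG u _ _ uT)) ?ltrDl.
  suff half : sup E <= sup E / 2.
    exists d => // t /andP[ut td] tT.
    have : `|G t| <= 0 by rewrite (le_trans (EG t (ltW ut) td tT))//; lra.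
    by rewrite normr_le0 mulf_eq0 gt_eqF ?expR_gt0//= => /eqP.
  apply: ge_sup => // _ [t [/andP[ut td] tT] <-].
  apply/ler_addgt0Pr => e e0; have e20 : 0 < e / 2 by rewrite divr_gt0.
  have eC0 : 0 < e / 2 / (sup E + 1) by rewrite divr_gt0// ltr_wpDl.
  have qs := psum_sq_le Pi_partition Pi_mesh X_QV u0 ut eC0.
  have /cvgr0Pnorm_le/(_ _ e20) rs := psum_weighted Vc Dc Ds Dcon u0 ut tT.
  near \oo => n; have P := Pi_partition n.
  have hq : psum (Pi n) (sq_incr X) u t <= Q t - Q u + e / 2 / (sup E + 1) by near: n.
  have hr : `|psum (Pi n) (fun x y => V y * linear_error X D x y) u t| <= e / 2.
    by near: n.
  (* The remainder of the product rule for exp(- X) D. *)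
  pose phi x := 1 - (1 + x) * expR (- x).
  have hphi : `|psum (Pi n) (fun x y => G x * phi (X y - X x)) u t| <=
      psum (Pi n) (fun x y => sup E * sq_incr X x y) u t.
    apply: psum_le => // x y ux xy yt; rewrite normrM.
    have yd1 : y < u + d1 by lra.
    have xd : x < u + d by lra.
    apply: ler_pM => //; first by apply: EG => //; lra.
    apply: expR_jump_bound; apply: Xd; apply/andP; split=> //.
      exact: lt_trans yd1.
    by rewrite (le_trans ux)// ltW.
  rewrite psumZ// in hphi.
  have tele : G t - G u =
      psum (Pi n) (fun x y => V y * linear_error X D x y) u t -
      psum (Pi n) (fun x y => G x * phi (X y - X x)) u t.
    rewrite -(psum_telescope P G u0 ut) -psumB//.
    apply: eq_psum => // x y _ _ _.
    have -> : G x * phi (X y - X x) =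
        V x * D x - (1 + (X y - X x)) * D x * (V x * expR (- (X y - X x))).
      by rewrite /G /phi; ring.
    have -> : V x * expR (- (X y - X x)) = V y.
      by rewrite /V -expRD; congr expR; ring.
    by rewrite /G /linear_error; ring.
  rewrite Gu subr0 in tele; rewrite tele.
  have hQ : Q t - Q u <= 2^-1.
    by apply: le_trans (ler_norm _) _; apply: Qd; apply/andP; split => //; lra.
  have hs : sup E * psum (Pi n) (sq_incr X) u t <= sup E / 2 + e / 2.
    apply: le_trans (ler_wpM2l supE0 hq) _; rewrite mulrDr lerD//.
      exact: ler_wpM2l.
    by rewrite mulr_div_succ_le// ltW.
  apply: le_trans (ler_normB _ _) _; lra.
- move=> u u0 IHu uT; apply/eqP; rewrite -normr_le0; apply/ler_addgt0Pr => e e0.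
  rewrite add0r; have [d d0 Rd] := Dl u e u0 uT e0.
  have [s [s0 sd su]] := left_approach u0 d0.
  have := Rd s s0; rewrite sd su => /(_ isT).
  have -> : linear_error X D s u = D u; last by [].
  have Ds0 : D s = 0 by apply: IHu; [rewrite s0|lra].
  by rewrite /linear_error Ds0 mul0r !subr0.
Unshelve. all: by end_near. Qed.

End uniqueness.
(** * A second order estimate for functions of class C^{1,2} *)

Section directional_mean_value.
Context {R : realType} {V : normedModType R}.
Implicit Types (f : V -> R) (p v : V).

Lemma is_derive_line f p v z : derivable f (p + z *: v) v ->
  is_derive z 1 (fun z => f (p + z *: v)) ('D_v f (p + z *: v)).
Proof.
move=> df; have E : (fun h => h^-1 *: (((fun z => f (p + z *: v)) \o shift z) (h *: 1%R)
    - f (p + z *: v))) =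
  (fun h => h^-1 *: ((f \o shift (p + z *: v)) (h *: v) - f (p + z *: v))).
  apply/funext => h /=; congr (_ *: (f _ - _)).
  by rewrite [h *: 1]mulr1 scalerDl addrCA.
by split; rewrite /derivable /derive E.
Qed.

(** The bounds Num.min 0 h and Num.max 0 h let h have either sign. *)
Lemma mean_value_line f p v (h : R) :
  (forall z : R, Num.min 0 h <= z <= Num.max 0 h -> derivable f (p + z *: v) v) ->
  exists2 c : R, Num.min 0 h <= c <= Num.max 0 h &
    f (p + h *: v) - f p = h * 'D_v f (p + c *: v).
Proof.
move=> df; pose g (z : R) := f (p + z *: v).
have dg (z : R) : Num.min 0 h <= z <= Num.max 0 h ->
    is_derive z 1 g ('D_v f (p + z *: v)).
  by move=> zh; exact: is_derive_line (df z zh).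
have cont (a b : R) : (forall z : R, a <= z <= b -> Num.min 0 h <= z <= Num.max 0 h) ->
    {within `[a, b], continuous g}.
  move=> ab; apply: derivable_within_continuous => z.
  by rewrite in_itv/= => zab; case: (dg z (ab z zab)).
have g0 : g 0 = f p by rewrite /g scale0r addr0.
have [h0|h0] := leP 0 h.
  have sub (z : R) : 0 <= z <= h -> Num.min 0 h <= z <= Num.max 0 h.
    by rewrite (min_idPl h0) (max_idPr h0).
  have [z|c c0h E] := MVT_segment h0 _ (cont _ _ sub) (df := fun z => 'D_v f (p + z *: v)).
    by rewrite in_itv/= => /andP[z0 zh]; apply/dg/sub; rewrite !ltW.
  exists c; first by rewrite in_itv in c0h.
  by rewrite -g0 -/(g h) E subr0 mulrC.
have sub (z : R) : h <= z <= 0 -> Num.min 0 h <= z <= Num.max 0 h.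
  by rewrite (min_idPr (ltW h0)) (max_idPl (ltW h0)).
have [z|c c0h E] := MVT_segment (ltW h0) _ (cont _ _ sub) (df := fun z => 'D_v f (p + z *: v)).
  by rewrite in_itv/= => /andP[z0 zh]; apply/dg/sub; rewrite !ltW.
exists c; first by rewrite in_itv in c0h.
rewrite -g0 -/(g h); move: E; rewrite sub0r => E.
by rewrite -opprB E mulrN opprK mulrC.
Qed.

End directional_mean_value.

Section taylor.
Context {R : realType} {m : nat}.
Implicit Types (p q : 'rV[R]_m * R) (f : 'rV[R]_m * R -> R).

(** Balls of the sup norm, in coordinates. *)
Definition box p (rho : R) q :=
  (forall i, `|q.1 0 i - p.1 0 i| < rho) /\ `|q.2 - p.2| < rho.

(** First order in a and second order in x, like the bound of taylor_local. *)
Definition deviation p q := \sum_i `|q.1 0 i - p.1 0 i| + (q.2 - p.2) ^+ 2.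

Definition taylor_rest f p q := f q - f p - 'D_dir_x f p * (q.2 - p.2).

Lemma box_nbhs p (P : 'rV[R]_m * R -> Prop) :
  (\forall q \near p, P q) <-> exists2 rho, 0 < rho & forall q, box p rho q -> P q.
Proof.
split=> [/nbhs_ballP[e /= e0 eP]|[e e0 eP]].
  exists e => // q [q1 q2]; apply: eP; split; last by rewrite /ball/= distrC.
  by split=> // i j; rewrite (ord1 i) /ball/= distrC.
apply/nbhs_ballP; exists e => //= q [[_ q1] q2]; apply: eP; split.
  by move=> i; rewrite distrC; exact: q1.
by rewrite distrC.
Qed.

Lemma deviation_ge0 p q : 0 <= deviation p q.
Proof. by rewrite addr_ge0 ?sqr_ge0 ?sumr_ge0. Qed.

(** The segment from a to b is replaced by m segments parallel to the axes, as
    only directional derivatives along the axes are available. The points c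
    are the vertices of the box with corners a and b. *)
Lemma coord_update_le (a b : 'rV[R]_m) (f : 'rV[R]_m -> R) (K : R) :
  (forall k (c : 'rV[R]_m) h,
     (forall i, c 0 i = a 0 i \/ c 0 i = b 0 i) -> c 0 k = a 0 k ->
     h = b 0 k - a 0 k ->
     `|f (c + h *: delta_mx 0 k) - f c| <= K * `|h|) ->
  `|f b - f a| <= K * \sum_i `|b 0 i - a 0 i|.
Proof.
move=> H.
pose c (k : nat) : 'rV[R]_m := \row_i (if (i < k)%N then b 0 i else a 0 i).
have c0 : c 0%N = a by apply/rowP => i; rewrite mxE ltn0.
have cm : c m = b by apply/rowP => i; rewrite mxE ltn_ord.
have := telescope_sumr (fun k => f (c k)) (leq0n m).
rewrite c0 cm => <-; rewrite big_mkord mulr_sumr.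
apply: le_trans (ler_norm_sum _ _ _) _; apply: ler_sum => k _.
have -> : c k.+1 = c k + (b 0 k - a 0 k) *: delta_mx 0 k.
  apply/rowP => i; rewrite !mxE eqxx/= ltnS leq_eqVlt.
  have [->|ik] := eqVneq i k; first by rewrite eqxx/= ltnn mulr1 addrC subrK.
  by rewrite -val_eqE /= in ik; rewrite (negbTE ik)/= mulr0 addr0.
apply: H => //; last by rewrite mxE ltnn.
by move=> i; rewrite mxE; case: ifP; [right|left].
Qed.

Lemma C12_local_bound (U : set ('rV[R]_m * R)) f p0 : open U -> C12_on U f -> U p0 ->
  exists (rho K : R), [/\ 0 < rho, 0 <= K & forall q, box p0 rho q ->
    [/\ U q, `|'D_dir_x f q| <= K, `|'D_dir_x ('D_dir_x f) q| <= K &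
       forall i, `|'D_(dir_a i) f q| <= K]].
Proof.
move=> Uo fC Up0; have [fa [_ fx] [_ fxx]] := fC p0 Up0.
pose K := `|'D_dir_x f p0| + `|'D_dir_x ('D_dir_x f) p0| +
  \sum_i `|'D_(dir_a i) f p0| + 1.
have s0 : 0 <= \sum_i `|'D_(dir_a i) f p0| by apply: sumr_ge0.
have near_bound (g : 'rV[R]_m * R -> R) : {for p0, continuous g} -> `|g p0| + 1 <= K ->
    \forall q \near p0, `|g q| <= K.
  move=> /cvgrPdist_le/(_ 1 ltr01) + gK; apply: filterS => q; rewrite distrC => gq.
  by have := lerB_dist (g q) (g p0); lra.
have : \forall q \near p0, [/\ U q, `|'D_dir_x f q| <= K, `|'D_dir_x ('D_dir_x f) q| <= K &
       forall i, `|'D_(dir_a i) f q| <= K].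
  near=> q; split; near: q.
  - exact: open_nbhs_nbhs.
  - by apply: near_bound => //; rewrite lerD2r -addrA lerDl addr_ge0.
  - apply: near_bound => //.
    by rewrite lerD2r [in leRHS](addrC `|_|) -addrA lerDl addr_ge0.
  - apply: filter_forall => i; apply: near_bound; first exact: (fa i).2.
    rewrite lerD2r; apply: (@le_trans _ _ (\sum_i `|'D_(dir_a i) f p0|)).
      by rewrite (bigD1 i)//= lerDl; exact: sumr_ge0.
    by rewrite lerDr addr_ge0.
move=> /box_nbhs[rho rho0 H]; exists rho, K; split=> //.
by rewrite !addr_ge0.
Unshelve. all: by end_near. Qed.

Lemma between_ball (c rho x x' z : R) : `|x - c| < rho -> `|x' - c| < rho ->
  Num.min 0 (x' - x) <= z <= Num.max 0 (x' - x) -> `|x + z - c| < rho.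
Proof.
rewrite !ltr_norml => /andP[p1 p2] /andP[q1 q2].
by case: (leP 0 (x' - x)) => _ /andP[z1 z2]; apply/andP; split; lra.
Qed.

Lemma between_trans (h z w : R) : Num.min 0 h <= z <= Num.max 0 h ->
  Num.min 0 z <= w <= Num.max 0 z -> Num.min 0 h <= w <= Num.max 0 h.
Proof.
by case: (leP 0 h) => ?; case: (leP 0 z) => ? /andP[? ?] /andP[? ?];
  apply/andP; split; lra.
Qed.

(** The order of the moves matters, since f_x need not be differentiable in a:
    x is moved first, where Taylor's formula applies at the base point, and a is
    moved afterwards, which costs only a bound on f_a. *)
Lemma taylor_local (U : set ('rV[R]_m * R)) f p0 : open U -> C12_on U f -> U p0 ->
  exists (rho K : R), [/\ 0 < rho, 0 <= K & forall p q, box p0 rho p -> box p0 rho q ->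
    `|taylor_rest f p q| <= K * deviation p q].
Proof.
move=> Uo fC Up0; have [rho [K [rho0 K0 H]]] := C12_local_bound Uo fC Up0.
exists rho, K; split=> // -[a x] [a' x'] [/= pa px] [/= qa qx].
pose h := x' - x.
have between (z : R) : Num.min 0 h <= z <= Num.max 0 h -> `|x + z - p0.2| < rho.
  exact: between_ball.
have step b (z : R) : (b, x) + z *: dir_x = (b, x + z).
  by congr (_, _); rewrite /= ?scaler0 ?addr0// [z *: 1]mulr1.
have boxx z : Num.min 0 h <= z <= Num.max 0 h -> box p0 rho ((a, x) + z *: dir_x).
  by move=> zh; rewrite step; split => //=; exact: between.
have zh_le (z : R) : Num.min 0 h <= z <= Num.max 0 h -> `|z| <= `|h|.
  case: (leP 0 h) => h0 /andP[? ?]; first by rewrite !ger0_norm.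
  by rewrite !ler0_norm ?lerN2// ltW.
have deriv z : Num.min 0 h <= z <= Num.max 0 h ->
    derivable f ((a, x) + z *: dir_x) dir_x /\
    derivable ('D_dir_x f) ((a, x) + z *: dir_x) dir_x.
  move=> /boxx/H[Uz _ _ _]; have [_ [? _] [? _]] := fC _ Uz; by split.
have [c ch fE] := mean_value_line (fun z zh => (deriv z zh).1).
have [d dc gE] := mean_value_line (fun z zc => (deriv z (between_trans ch zc)).2).
have xstep : `|f (a, x') - f (a, x) - 'D_dir_x f (a, x) * h| <= K * h ^+ 2.
  have -> : (a, x') = (a, x) + h *: dir_x by rewrite step /h addrC subrK.
  rewrite fE [_ * h]mulrC -mulrBr gE normrM.
  have [_ _ Hd _] := H _ (boxx d (between_trans ch dc)).
  have -> : K * h ^+ 2 = `|h| * (`|h| * K) by rewrite mulrA -expr2 real_normK ?num_real// mulrC.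
  by rewrite ler_wpM2l// normrM ler_pM// zh_le.
have astep : `|f (a', x') - f (a, x')| <= K * \sum_i `|a' 0 i - a 0 i|.
  apply: (@coord_update_le a a' (fun b => f (b, x'))) => k b l bi bk lE.
  have stepa (z : R) : (b, x') + z *: dir_a k = (b + z *: delta_mx 0 k, x').
    by congr (_, _); rewrite /= scaler0 addr0.
  have boxa (z : R) : Num.min 0 l <= z <= Num.max 0 l -> box p0 rho ((b, x') + z *: dir_a k).
    move=> zl; rewrite stepa; split=> //= i; rewrite !mxE eqxx/=.
    have [->|ik] := eqVneq i k; last first.
      by rewrite mulr0 addr0; case: (bi i) => ->.
    rewrite mulr1 bk; apply: between_ball (pa k) (qa k) _.
    by rewrite -lE.
  have deriva z : Num.min 0 l <= z <= Num.max 0 l ->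
      derivable f ((b, x') + z *: dir_a k) (dir_a k).
    by move=> /boxa/H[Uz _ _ _]; have [/(_ k)[]] := fC _ Uz.
  have [e el E] := mean_value_line deriva.
  rewrite -stepa E normrM mulrC ler_wpM2r//.
  by have [_ _ _ /(_ k)] := H _ (boxa e el).
rewrite /taylor_rest /deviation/= -/h.
rewrite (_ : _ - _ - _ = (f (a', x') - f (a, x')) +
  (f (a, x') - f (a, x) - 'D_dir_x f (a, x) * h)); last by ring.
by rewrite [leRHS]mulrDr; apply: le_trans (ler_normD _ _) _; exact: lerD.
Qed.

Lemma box_le p rho rho' q : rho <= rho' -> box p rho q -> box p rho' q.
Proof.
move=> rr [q1 q2]; split=> [i|]; exact: lt_le_trans rr.
Qed.

Lemma box_center p rho : 0 < rho -> box p rho p.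
Proof. by move=> rho0; split=> [i|]; rewrite subrr normr0. Qed.

Lemma C12_locally_bounded (U : set ('rV[R]_m * R)) f p : open U -> C12_on U f -> U p ->
  exists (rho B : R), 0 < rho /\ forall q, box p rho q ->
    `|f q| <= B /\ `|'D_dir_x f q| <= B.
Proof.
move=> Uo fC Up.
have [r1 [K [r10 K0 H1]]] := C12_local_bound Uo fC Up.
have [r2 [L [r20 L0 H2]]] := taylor_local Uo fC Up.
pose rho := Num.min (Num.min r1 r2) 1.
have [rr1 rr2 rr3] : [/\ rho <= r1, rho <= r2 & rho <= 1].
  by rewrite /rho !ge_min !lexx !orbT.
have rho0 : 0 < rho by rewrite !lt_min r10 r20 ltr01.
exists rho, (`|f p| + K + L * (m%:R + 1)); split=> // q qb.
have [Uq Kq _ _] := H1 q (box_le rr1 qb); split; last first.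
  have : 0 <= L * (m%:R + 1) by rewrite mulr_ge0// addr_ge0// ler0n.
  by have := normr_ge0 (f p); lra.
have [_ Kp _ _] := H1 p (box_center p r10).
have [q1 q2] := box_le rr3 qb.
have dev : deviation p q <= m%:R + 1.
  apply: lerD.
    apply: le_trans (ler_sum _ (fun i _ => ltW (q1 i))) _.
    by rewrite sumr_const card_ord.
  by rewrite -real_normK ?num_real// exprn_ile1// ltW.
have := H2 p q (box_center p r20) (box_le rr2 qb); rewrite /taylor_rest => h.
have hd := ler_wpM2l L0 dev.
have hx : `|'D_dir_x f p * (q.2 - p.2)| <= K.
  by rewrite normrM -[leRHS]mulr1 ler_pM// ltW.
rewrite (_ : f q = (f q - f p - 'D_dir_x f p * (q.2 - p.2)) + f p +
  'D_dir_x f p * (q.2 - p.2)); last by ring.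
apply: le_trans (ler_normD _ _) _.
have := ler_normD (f q - f p - 'D_dir_x f p * (q.2 - p.2)) (f p); lra.
Qed.

Lemma deviation_separated p q : p <> q ->
  exists (rho eta : R), [/\ 0 < rho, 0 < eta & forall p' q', box p rho p' -> box q rho q' ->
    eta <= deviation p' q'].
Proof.
move=> pq; have tri (a b a' b' : R) e : `|a' - a| < e / 4 -> `|b' - b| < e / 4 ->
    e = `|b - a| -> e / 2 <= `|b' - a'|.
  move=> h1 h2 eE; have := ler_normD (b' - a') ((a' - a) - (b' - b)).
  have := ler_normB (a' - a) (b' - b).
  rewrite (_ : b' - a' + (a' - a - (b' - b)) = b - a); last by ring.
  by rewrite -eE; lra.
have [x12|] := eqVneq p.2 q.2; last first.
  move=> x12; pose e := `|q.2 - p.2|.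
  have e0 : 0 < e by rewrite normr_gt0 subr_eq0 eq_sym.
  exists (e / 4), ((e / 2) ^+ 2); split; [by rewrite divr_gt0|by rewrite exprn_gt0 ?divr_gt0|].
  move=> p' q' [_ hp] [_ hq]; rewrite /deviation.
  have h := tri _ _ _ _ e hp hq erefl.
  rewrite -[(q'.2 - p'.2) ^+ 2]real_normK ?num_real//.
  have : (e / 2) ^+ 2 <= `|q'.2 - p'.2| ^+ 2.
    by rewrite lerXn2r// nnegrE divr_ge0// ltW.
  move/le_trans; apply; rewrite lerDr; exact: sumr_ge0.
have [i ai] : exists i, p.1 0 i != q.1 0 i.
  apply/existsP; rewrite -[X in is_true X]negbK negb_exists; apply/negP => /forallP H.
  apply: pq; rewrite [p]surjective_pairing [q]surjective_pairing x12; congr (_, _).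
  by apply/rowP => i; have := H i; rewrite negbK => /eqP.
pose e := `|q.1 0 i - p.1 0 i|.
have e0 : 0 < e by rewrite normr_gt0 subr_eq0 eq_sym.
exists (e / 4), (e / 2); split; [by rewrite divr_gt0|by rewrite divr_gt0|].
move=> p' q' [hp _] [hq _]; rewrite /deviation.
have := tri _ _ _ _ e (hp i) (hq i) erefl.
move/le_trans; apply; rewrite (bigD1 i)//= -addrA lerDl addr_ge0 ?sqr_ge0//.
exact: sumr_ge0.
Qed.

(** A path may jump between points whose joining segment leaves U, so the
    local estimate must be extended to distant pairs. Near such a pair
    of distinct points, deviation is bounded below and the rest is bounded
    above. Compactness of K x K makes the constant uniform. *)
Lemma taylor_compact (U K : set ('rV[R]_m * R)) f : open U -> C12_on U f ->
  K `<=` U -> compact K ->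
  exists2 C, 0 <= C & forall p q, K p -> K q ->
    `|taylor_rest f p q| <= C * deviation p q.
Proof.
move=> Uo fC KU Kc.
have := compact_setX Kc Kc.
move=> /compact_near_coveringP/(_ _ (pinfty_nbhs R)
  (fun C z => `|taylor_rest f z.1 z.2| <= C * deviation z.1 z.2)) H.
suff /H HC : forall z, (K `*` K) z -> \forall z' \near z & C \near +oo,
    `|taylor_rest f z'.1 z'.2| <= C * deviation z'.1 z'.2.
  near (pinfty_nbhs R) => C.
  exists C => [|p q Kp Kq]; first by near: C; exact: nbhs_pinfty_ge.
  have : K `*` K `<=` (fun z => `|taylor_rest f z.1 z.2| <= C * deviation z.1 z.2).
    by near: C.
  by move=> /(_ (p, q)); apply.
move=> [p q] [/= Kp Kq]; have [<-|/eqP pq] := eqVneq p q.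
  have [rho [L [rho0 L0 HL]]] := taylor_local Uo fC (KU p Kp).
  have Hp : \forall p' \near p, box p rho p' by apply/box_nbhs; exists rho.
  exists ([set z | box p rho z.1 /\ box p rho z.2], [set C | L <= C]) => /=.
    split; last by apply: nbhs_pinfty_ge; exact: num_real.
    by exists (box p rho, box p rho).
  move=> [[p' q'] C] /= [[bp bq] LC].
  by rewrite (le_trans (HL _ _ bp bq))// ler_wpM2r// deviation_ge0.
have [r1 [B1 [r10 H1]]] := C12_locally_bounded Uo fC (KU p Kp).
have [r2 [B2 [r20 H2]]] := C12_locally_bounded Uo fC (KU q Kq).
have [r3 [eta [r30 eta0 H3]]] := deviation_separated pq.
pose rp := Num.min (Num.min r1 r3) 1; pose rq := Num.min (Num.min r2 r3) 1.
have rp0 : 0 < rp by rewrite !lt_min r10 r30 ltr01.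
have rq0 : 0 < rq by rewrite !lt_min r20 r30 ltr01.
have [p1 p3 p4] : [/\ rp <= r1, rp <= r3 & rp <= 1].
  by rewrite /rp !ge_min !lexx !orbT.
have [q2 q3 q4] : [/\ rq <= r2, rq <= r3 & rq <= 1].
  by rewrite /rq !ge_min !lexx !orbT.
have Hp : \forall p' \near p, box p rp p' by apply/box_nbhs; exists rp.
have Hq : \forall q' \near q, box q rq q' by apply/box_nbhs; exists rq.
(* L bounds the rest near (p, q), while deviation is at least eta there. *)
pose L := B1 + B2 + B1 * (2 + `|q.2 - p.2|).
exists ([set z | box p rp z.1 /\ box q rq z.2], [set C | L / eta <= C]) => /=.
  split; last by apply: nbhs_pinfty_ge; exact: num_real.
  by exists (box p rp, box q rq).
move=> [[p' q'] C] /= [[bp bq] LC].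
have [fp Dp] := H1 _ (box_le p1 bp); have [fq _] := H2 _ (box_le q2 bq).
have dev := H3 _ _ (box_le p3 bp) (box_le q3 bq).
have B10 : 0 <= B1 := le_trans (normr_ge0 _) fp.
have B20 : 0 <= B2 := le_trans (normr_ge0 _) fq.
have L0 : 0 <= L by rewrite !addr_ge0// mulr_ge0// addr_ge0.
have C0 : 0 <= C by rewrite (le_trans _ LC)// divr_ge0// ltW.
apply: (@le_trans _ _ L); last first.
  apply: (@le_trans _ _ (C * eta)); last by rewrite ler_wpM2l.
  by rewrite -ler_pdivrMr.
have dx : `|q'.2 - p'.2| <= 2 + `|q.2 - p.2|.
  have [_ bp2] := box_le p4 bp; have [_ bq2] := box_le q4 bq.
  rewrite (_ : q'.2 - p'.2 = (q'.2 - q.2) - (p'.2 - p.2) + (q.2 - p.2)); last by ring.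
  apply: le_trans (ler_normD _ _) _; rewrite lerD2r.
  apply: le_trans (ler_normB _ _) _; lra.
rewrite /taylor_rest; apply: le_trans (ler_normB _ _) _.
apply: lerD; first by rewrite (le_trans (ler_normB _ _))// addrC lerD.
by rewrite normrM ler_pM.
Unshelve. all: by end_near. Qed.

End taylor.
(** * Uniqueness of the solution *)

Section bounded_variation_control.
Context {R : realType}.
Implicit Types (A N Q : R -> R) (T s t : R).

Lemma bounded_variation_control T A : bounded_variation 0 T A ->
  exists N : R -> R,
    forall s t, 0 <= s -> s <= t -> t <= T -> `|A t - A s| <= N t - N s.
Proof.
move=> bvA; exists (fun t => fine (total_variation 0 t A)) => s t s0 st tT.
have t0 := le_trans s0 st.
have fs : total_variation 0 s A \is a fin_num.
  apply/bounded_variationP => //.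
  by apply: bounded_variationl bvA => //; exact: le_trans tT.
have ft : total_variation 0 t A \is a fin_num.
  by apply/bounded_variationP => //; apply: bounded_variationl bvA.
rewrite lerBrDl -lee_fin EFinD !fineK// (total_variationD A s0 st).
by rewrite leeD2lE// total_variation_ge.
Qed.

Lemma bounded_variation_le T A Q : 0 < T ->
  (forall s t, 0 <= s -> s <= t -> t <= T -> `|A t - A s| <= Q t - Q s) ->
  bounded_variation 0 T A.
Proof.
move=> T0 AQ.
(* A + Q and Q are nondecreasing. *)
have -> : A = (fun t => A t + Q t) \+ (\- Q) by apply/funext => t /=; rewrite addrK.
apply: bounded_variationD => //.
  apply: nondecreasing_bounded_variation => s t.
  rewrite !in_itv/= => /andP[s0 _] /andP[_ tT] st.
  by have := AQ s t s0 st tT; rewrite ler_norml => /andP[+ _]; lra.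
apply: bounded_variationN; apply: nondecreasing_bounded_variation => s t.
rewrite !in_itv/= => /andP[s0 _] /andP[_ tT] st.
by rewrite -subr_ge0 (le_trans _ (AQ s t s0 st tT)).
Qed.

End bounded_variation_control.

Section solutions.
Context {R : realType}.
Variables (Pi : nat -> nat -> R) (X : R -> R).
Hypothesis Pi_partition : forall n, is_partition (Pi n).
Hypothesis Pi_mesh : mesh (Pi n) @[n --> \oo] --> 0%E.
Hypothesis X_QV : QV Pi X.
Implicit Types (Y : R -> R) (T s t : R).

(** An integrand f_x(A, X) has the primitive f(A, X) up to second order. *)
Lemma admissible_primitive Y T : admissible_integrand X Y -> 0 < T ->
  exists (g N : R -> R) (C : R), [/\ 0 <= C,
    forall s t, 0 <= s -> s <= t -> t <= T -> N s <= N t &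
    forall s t, 0 <= s -> s <= t -> t <= T ->
      `|g t - g s - Y s * (X t - X s)| <= N t - N s + C * sq_incr X s t].
Proof.
move=> [_ Yadm] T0; have [m [U [f [A [Uo fC AFV Yf [KU Kc]]]]]] := Yadm T T0.
pose AX t := (\row_i A i t, X t).
have [C C0 HC] := taylor_compact Uo fC (@subIsetr _ _ _) Kc.
have AXK t : 0 <= t -> t <= T -> (closure (AX @` `[0, T]) `&` U) (AX t).
  move=> t0 tT; have im : (AX @` `[0, T]) (AX t).
    by exists t => //=; rewrite in_itv/= t0.
  by split; [exact: subset_closure|exact: KU].
have /choice[N HN] : forall i, exists N : R -> R,
    forall s t, 0 <= s -> s <= t -> t <= T -> `|A i t - A i s| <= N t - N s.
  by move=> i; apply: bounded_variation_control; exact: (AFV i).2.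
exists (fun t => f (AX t)), (fun t => C * \sum_i N i t), C; split=> // s t s0 st tT.
  apply: ler_wpM2l => //; apply: ler_sum => i _; rewrite -subr_ge0.
  by rewrite (le_trans _ (HN i s t s0 st tT)).
have t0 := le_trans s0 st; have sT := le_trans st tT.
have := HC _ _ (AXK s s0 sT) (AXK t t0 tT).
rewrite /taylor_rest -Yf ?s0// => /le_trans; apply.
rewrite -mulrBr -mulrDr ler_wpM2l// lerD// -sumrB.
by apply: ler_sum => i _; rewrite !mxE HN.
Qed.

Lemma linear_solution_start Y : linear_solution Pi X Y -> Y 0 = 1.
Proof.
move=> [_ Ysol]; have [_ ->] := Ysol 0 (lexx 0).
suff -> : ito_integral Pi Y X 0 = 0 by rewrite addr0.
rewrite /ito_integral; apply/cvg_lim => //.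
rewrite (_ : (fun n => _) = fun=> 0); first exact: cvg_cst.
by apply/funext => n; rewrite ito_sumE// psumxx.
Qed.

Lemma linear_solution_solves Y T : linear_solution Pi X Y -> solves Pi X Y T.
Proof.
move=> Ysol t t0 _; have Y0 := linear_solution_start Ysol.
have [Yint Yt] := Ysol.2 t t0.
apply: (@cvg_to0 _ _ _ _ (fun n => Y t - Y 0 - ito_sum (Pi n) Y X t)
  (Y t - Y 0 - ito_integral Pi Y X t)).
- move=> n; have P := Pi_partition n.
  rewrite ito_sumE// -(psum_telescope P Y (lexx 0) t0) -psumB//.
- by rewrite {1}Yt Y0; ring.
by apply: cvgB => //; exact: cvg_cst.
Qed.

Lemma linear_solution_unique Y1 Y2 t : linear_solution Pi X Y1 ->
  linear_solution Pi X Y2 -> 0 <= t -> Y1 t = Y2 t.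
Proof.
move=> Y1sol Y2sol t0; pose T := t + 1.
have T0 : 0 < T by rewrite ltr_wpDl.
have Y1c : cadlag Y1 by case: Y1sol => -[].
have Y2c : cadlag Y2 by case: Y2sol => -[].
have s1 := linear_solution_solves (T := T) Y1sol.
have s2 := linear_solution_solves (T := T) Y2sol.
have c1 : controlled X Y1 T.
  have [g [N [C [C0 Nm gN]]]] := admissible_primitive Y1sol.1 T0.
  exact: (controlled_of_primitive Pi_partition Pi_mesh X_QV Y1c s1 C0 Nm gN).
have c2 : controlled X Y2 T.
  have [g [N [C [C0 Nm gN]]]] := admissible_primitive Y2sol.1 T0.
  exact: (controlled_of_primitive Pi_partition Pi_mesh X_QV Y2c s2 C0 Nm gN).
apply/eqP; rewrite -subr_eq0; apply/eqP.
apply: (solution_eq0 Pi_partition Pi_mesh X_QV (D := fun t => Y1 t - Y2 t) (T := T)) => //.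
- exact: cadlagB.
- by rewrite !linear_solution_start// subrr.
- exact: solvesB.
- exact: controlledB.
- by rewrite lerDl.
Qed.

End solutions.
(** * Estimates for the exponential function *)

Section exponential_estimates.
Context {R : realType}.
Implicit Types x h e : R.

Lemma expR_ltD1sq h : `|h| <= 2^-1 -> `|expR h - 1 - h| <= 2 * h ^+ 2.
Proof.
rewrite ler_norml => /andP[h1 h2].
have lo := expR_ge1Dx h; have lo' := expR_ge1Dx (- h).
have := expRxMexpNx_1 h; have := expR_gt0 h.
move: (expR h) (expR (- h)) lo lo' => E F lo lo' E0 EF.
rewrite ger0_norm; last lra.
have : E * (1 - h) <= 1 by rewrite -[leRHS]EF ler_pM2l.
nra.
Qed.

Lemma expR_taylor2 h : `|h| <= 2^-1 ->
  `|expR h - 1 - h - 2^-1 * h ^+ 2| <= 2 * `|h| ^+ 3.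
Proof.
move=> h12.
pose g z : R := expR z - 1 - z - 2^-1 * z ^+ 2.
have g0 : g 0 = 0 by rewrite /g expR0 expr0n/=; ring.
have dg (z : R) : is_derive z 1 g (expR z - 1 - z).
  rewrite (_ : _ - _ - _ = expR z - 0 - 1 - 2^-1 * (2 * z)); last by field.
  rewrite /g; apply: is_derive_eq.
  by rewrite /GRing.scale/= mulr1; ring.
have bound (z : R) : `|z| <= `|h| -> `|expR z - 1 - z| <= 2 * h ^+ 2.
  move=> zh; apply: le_trans (expR_ltD1sq (le_trans zh h12)) _.
  rewrite ler_pM2l// -(real_normK (num_real z)) -(real_normK (num_real h)).
  by rewrite lerXn2r// nnegrE.
have cont : continuous g.
  by move=> z; apply: differentiable_continuous; apply/derivable1_diffP; case: (dg z).
have -> : 2 * `|h| ^+ 3 = 2 * h ^+ 2 * `|h|.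
  by rewrite -(real_normK (num_real h)); ring.
rewrite -/(g h) -[g h]subr0 -g0.
have [h0|h0] := leP 0 h.
  have [|c] := MVT_segment h0 (fun z _ => dg z).
    exact: continuous_subspaceT.
  rewrite in_itv/= => /andP[c0 ch] ->; rewrite subr0 normrM ler_wpM2r// bound//.
  by rewrite !ger0_norm.
have [|c] := MVT_segment (ltW h0) (fun z _ => dg z).
  exact: continuous_subspaceT.
rewrite in_itv/= => /andP[c0 ch] E; rewrite distrC E sub0r mulrN normrN normrM.
by rewrite ler_wpM2r// bound// !ler0_norm ?lerN2// ltW.
Qed.

Lemma expR_quadratic_between (a x : R) : 0 <= a -> a <= 1 -> `|x| <= 12^-1 ->
  `|expR (x - a * x ^+ 2) - (1 + x + (2^-1 - a) * x ^+ 2)| <= 6 * `|x| * x ^+ 2.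
Proof.
move=> a0 a1 x12.
pose h := x - a * x ^+ 2.
have hE : `|h| = `|x| * `|1 - a * x| by rewrite /h -normrM; congr `|_|; ring.
have ax : `|a * x| <= `|x| by rewrite normrM (ger0_norm a0) ler_piMl.
have ax1 : `|1 - a * x| <= 13 / 12.
  by apply: le_trans (ler_normB _ _) _; rewrite normr1; lra.
have hx : `|h| <= `|x| * (13 / 12) by rewrite hE ler_wpM2l.
have h12 : `|h| <= 2^-1 by lra.
have T := expR_taylor2 h12.
rewrite -/h.
have -> : expR h - (1 + x + (2^-1 - a) * x ^+ 2) =
  (expR h - 1 - h - 2^-1 * h ^+ 2) + 2^-1 * x ^+ 2 * (- (2 * (a * x)) + (a * x) ^+ 2).
  by rewrite {3 4}/h; field.
have h3 : 2 * `|h| ^+ 3 <= 4 * `|x| * x ^+ 2.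
  rewrite -(real_normK (num_real x)).
  have : `|h| ^+ 3 <= (`|x| * (13 / 12)) ^+ 3 by rewrite lerXn2r// nnegrE mulr_ge0.
  have c3 : (13 / 12 : R) ^+ 3 <= 2 by rewrite !exprS expr0; lra.
  have := ler_wpM2l (exprn_ge0 3 (normr_ge0 x)) c3; rewrite -exprMn.
  rewrite (_ : 4 * _ * _ = 4 * `|x| ^+ 3); last by ring.
  lra.
have q3 : `|2^-1 * x ^+ 2 * (- (2 * (a * x)) + (a * x) ^+ 2)| <= 2 * `|x| * x ^+ 2.
  have x20 : 0 <= 2^-1 * x ^+ 2 by apply: mulr_ge0 => //; exact: sqr_ge0.
  rewrite normrM (ger0_norm x20).
  rewrite (_ : 2 * `|x| * _ = 2^-1 * x ^+ 2 * (4 * `|x|)); last by field.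
  apply: ler_wpM2l => //.
  apply: le_trans (ler_normD _ _) _; rewrite normrN normrM normr_nat normrX.
  have : `|a * x| ^+ 2 <= `|a * x|.
    by rewrite expr2 ler_piMl//; lra.
  by have := normr_ge0 x; lra.
apply: le_trans (ler_normD _ _) _; apply: le_trans (lerD (le_trans T h3) q3) _.
by rewrite -!mulrDl; apply: ler_wpM2r; [exact: sqr_ge0|have := normr_ge0 x; lra].
Qed.

(** (1 + x) exp(- x) = exp(- x ^+ 2 / 2 + o(x ^+ 2)), in a form that
    multiplies over the jumps of an interval. *)
Lemma jump_factor_squeeze (e x : R) : 0 < e -> e <= 2^-1 -> `|x| <= e / 6 ->
  expR (- (2^-1 + e) * x ^+ 2) <= (1 + x) * expR (- x) <=
  expR (- (2^-1 - e) * x ^+ 2).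
Proof.
move=> e0 e12 xe.
have x12 : `|x| <= 12^-1 by lra.
have key a : 0 <= a -> a <= 1 -> expR (- a * x ^+ 2) = expR (x - a * x ^+ 2) * expR (- x).
  by move=> _ _; rewrite -expRD; congr expR; ring.
have x2 : 0 <= x ^+ 2 by exact: sqr_ge0.
have xe2 : 6 * `|x| * x ^+ 2 <= e * x ^+ 2 by rewrite ler_wpM2r//; lra.
have up0 : 0 <= 2^-1 + e by lra.
have up1 : 2^-1 + e <= 1 by lra.
have lo0 : 0 <= 2^-1 - e by lra.
have lo1 : 2^-1 - e <= 1 by lra.
rewrite !key// !ler_pM2r ?expR_gt0//.
have := expR_quadratic_between up0 up1 x12.
have := expR_quadratic_between lo0 lo1 x12.
rewrite !ler_norml.
move: (expR _) (expR _) => E F /andP[H1 H2] /andP[H3 H4]; apply/andP; split; lra.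
Qed.

Lemma expR_half_between (e h w : R) : 0 < e -> e <= 2^-1 -> 0 <= h -> h <= e ->
  expR (- (2^-1 + e) * h) <= w <= expR (- (2^-1 - e) * h) ->
  `|w - 1 + 2^-1 * h| <= 3 * e * h.
Proof.
move=> e0 e12 h0 he /andP[w1 w2].
have lo := expR_ge1Dx (- (2^-1 + e) * h).
have hh : `|- (2^-1 - e) * h| <= 2^-1.
  rewrite mulNr normrN ger0_norm ?mulr_ge0//; last lra.
  nra.
have := expR_ltD1sq hh; rewrite ler_norml => /andP[_ up].
have he2 : h * h <= e * h by rewrite ler_wpM2r.
have up2 : (- (2^-1 - e) * h) ^+ 2 <= h * h.
  rewrite expr2 (_ : _ * _ = (2^-1 - e) ^+ 2 * (h * h)); last by ring.
  rewrite ler_piMl ?mulr_ge0// expr2; nra.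
rewrite ler_norml; apply/andP; split; lra.
Qed.

Lemma expRB1_le (x : R) : expR x - 1 <= x * expR x.
Proof.
have := expR_ge1Dx (- x); have := expRxMexpNx_1 x; have := expR_gt0 x.
move: (expR x) (expR (- x)) => E F E0 EF F1.
have : E * (1 - x) <= 1 by rewrite -[leRHS]EF ler_pM2l.
lra.
Qed.

Lemma expRB1_mul_le (K h H : R) : 0 <= K -> 0 <= h -> h <= H ->
  expR (K * h) - 1 <= K * expR (K * H) * h.
Proof.
move=> K0 h0 hH; apply: le_trans (expRB1_le _) _; rewrite [leLHS]mulrAC.
by rewrite ler_wpM2r// ler_wpM2l// ler_expR ler_wpM2l.
Qed.

Lemma mul_expRN_dist1_le (p b d h : R) : `|p - 1| <= b -> 0 <= d -> d <= h ->
  `|p * expR (- (2^-1 * d)) - 1| <= b + h.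
Proof.
move=> pb d0 dh; have e1 := expR_ge1Dx (- (2^-1 * d)).
have e2 : expR (- (2^-1 * d)) <= 1.
  by rewrite -[leRHS]expR0 ler_expR oppr_le0 mulr_ge0.
have e0 := expR_ge0 (- (2^-1 * d)).
move: (expR _) e0 e1 e2 => E e0 e1 e2.
rewrite (_ : p * E - 1 = (p - 1) * E + (E - 1)); last by ring.
apply: le_trans (ler_normD _ _) _; apply: lerD.
  by rewrite normrM; apply: le_trans pb; rewrite ler_piMr// ger0_norm.
by rewrite ler0_norm; lra.
Qed.

(** Jumps below - 1 make the factor negative; their size is bounded by B, which
    only affects the constant. *)
Lemma jump_factor_bound (B x : R) : `|x| <= B ->
  `|(1 + x) * expR (- x) - 1| <= (1 + expR B) * x ^+ 2.
Proof.
move=> xB; have E0 := expR_gt0 B; have x2 := sqr_ge0 x.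
have [x1|x1] := leP 0 (1 + x).
  rewrite distrC; have h1 : (1 + x) * expR (- x) <= 1.
    rewrite -[leRHS](expRxMexpNx_1 x) ler_pM2r ?expR_gt0//; exact: expR_ge1Dx.
  have h2 : (1 + x) * (1 - x) <= (1 + x) * expR (- x).
    by apply: ler_wpM2l => //; exact: expR_ge1Dx.
  rewrite ger0_norm; last lra.
  nra.
have hB : expR (- x) <= expR B.
  by rewrite ler_expR (le_trans _ xB)// -normrN ler_norm.
have F0 := expR_gt0 (- x).
rewrite ler0_norm; last nra.
have : - (1 + x) * expR (- x) <= x ^+ 2 * expR B by rewrite ler_pM//; nra.
nra.
Qed.

End exponential_estimates.
(** * Unordered sums and products *)

Section unordered_products.
Context {R : realType} {I : choiceType}.
Implicit Types (a b : pred I) (y u : I -> R) (J : {fset I}).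

Notation totally := (@summability.totally I).

Existing Instance summability.totally_filter.

Definition net_sum a y : R :=
  lim ((fun J : {fset I} => \sum_(i <- J | a i) y i) @ totally).

Definition net_prod a u : R :=
  lim ((fun J : {fset I} => \prod_(i <- J | a i) u i) @ totally).

Definition bounded_sums a y (M : R) :=
  forall J : {fset I}, \sum_(i <- J | a i) `|y i| <= M.

Lemma big_subfset (S : Type) (idx : S) (op : Monoid.com_law idx) a (F : I -> S)
    (A J : {fset I}) : (A `<=` J)%fset ->
  \big[op/idx]_(i <- J | a i) F i = op (\big[op/idx]_(i <- A | a i) F i)
    (\big[op/idx]_(i <- J | a i && (i \notin A)) F i).
Proof.
move=> AJ; rewrite (bigID (fun i => i \in A))/=; congr (op _ _).
apply: eq_fbigl_cond => i; rewrite !inE.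
apply/idP/idP => [/and3P[_ ai iA]|/andP[iA ai]]; first by apply/andP; split.
by apply/and3P; split=> //; exact: (fsubsetP AJ).
Qed.

Lemma bounded_sums_tail a y M e : bounded_sums a y M -> 0 < e ->
  exists A : {fset I}, forall J, (A `<=` J)%fset ->
    \sum_(i <- J | a i && (i \notin A)) `|y i| <= e.
Proof.
move=> yM e0.
pose E := [set \sum_(i <- J | a i) `|y i| | J in [set: {fset I}]].
have supE : has_sup E.
  split; first by exists (\sum_(i <- fset0 | a i) `|y i|), fset0.
  by exists M => _ [J _ <-]; exact: yM.
have [_ [A _ <-] Ae] := sup_adherent e0 supE.
exists A => J AJ; have : \sum_(i <- J | a i) `|y i| <= sup E.
  by apply: (ub_le_sup supE.2); exists J.
rewrite (big_subfset _ a (fun i => `|y i|) AJ)/=; lra.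
Qed.

(** Expanding the product, the terms other than 1 are dominated by those of
    the product of the 1 + |y i|. *)
Lemma norm_prod1D_le (l : seq I) a y :
  `|\prod_(i <- l | a i) (1 + y i) - 1| <= expR (\sum_(i <- l | a i) `|y i|) - 1.
Proof.
elim: l => [|i l IH]; first by rewrite !big_nil expR0 !subrr normr0.
rewrite !big_cons; case: ifP => // _; rewrite expRD.
move: (\prod_(j <- l | a j) (1 + y j)) (\sum_(j <- l | a j) `|y j|) IH => p S IH.
have p_le : `|p| <= expR S.
  by have := ler_normD (p - 1) 1; rewrite subrK normr1; lra.
rewrite (_ : (1 + y i) * p - 1 = (p - 1) + y i * p); last by ring.
apply: le_trans (ler_normD _ _) _; rewrite normrM.
have h1 := ler_wpM2l (normr_ge0 (y i)) p_le.
have h2 := ler_wpM2r (expR_ge0 S) (expR_ge1Dx `|y i|).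
lra.
Qed.

Lemma cvg_totally (f : {fset I} -> R) :
  (forall e, 0 < e -> exists A : {fset I}, forall J, (A `<=` J)%fset ->
     `|f A - f J| < e) ->
  cvg (f @ totally).
Proof.
move=> fc; have fcauchy : cauchy_ex (f @ totally).
  by move=> e e0; have [A fA] := fc e e0; exists (f A), A => // J; exact: fA.
exact: (cauchy_cvg _ (cauchy_exP _ fcauchy)).
Qed.

Lemma cvg_net_sum a y M : bounded_sums a y M ->
  (fun J : {fset I} => \sum_(i <- J | a i) y i) @ totally --> net_sum a y.
Proof.
move=> yM; apply: cvg_totally => e e0; have e20 : 0 < e / 2 by rewrite divr_gt0.
have [A HA] := bounded_sums_tail yM e20.
exists A => J AJ; rewrite (big_subfset _ a y AJ)/= opprD addrA subrr sub0r normrN.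
apply: le_lt_trans (ler_norm_sum _ _ _) _.
by apply: le_lt_trans (HA J AJ) _; lra.
Qed.

(** Factors may vanish, so no logarithm is taken: the net is Cauchy, because
    enlarging a finite set multiplies the product by a factor close to 1. *)
Lemma cvg_net_prod a u M : bounded_sums a (fun i => u i - 1) M ->
  (fun J : {fset I} => \prod_(i <- J | a i) u i) @ totally --> net_prod a u.
Proof.
move=> uM; apply: cvg_totally => e e0.
have uE (l : seq I) b : \prod_(i <- l | b i) u i = \prod_(i <- l | b i) (1 + (u i - 1)).
  by apply: eq_bigr => i _; rewrite addrC subrK.
have c0 : 0 < e / (2 * expR M) / (1 + e / (2 * expR M)).
  have : 0 < e / (2 * expR M) by rewrite divr_gt0// mulr_gt0// expR_gt0.
  by move=> h; rewrite divr_gt0// addr_gt0.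
have [A HA] := bounded_sums_tail uM c0.
exists A => J AJ; rewrite (big_subfset _ a u AJ)/=.
set p := \prod_(i <- A | a i) u i; set q := \prod_(i <- J | _) u i.
have pM : `|p| <= expR M.
  rewrite /p uE; have := norm_prod1D_le A a (fun i => u i - 1).
  have : expR (\sum_(i <- A | a i) `|u i - 1|) <= expR M by rewrite ler_expR uM.
  rewrite -/p; have := lerB_dist (\prod_(i <- A | a i) (1 + (u i - 1))) 1.
  rewrite normr1; lra.
have q1 : `|q - 1| <= e / (2 * expR M).
  rewrite /q uE; apply: le_trans (norm_prod1D_le _ _ _) _.
  have := HA J AJ; set S := \sum_(i <- J | _) _ => SA.
  have : expR S <= 1 + e / (2 * expR M).
    set d := e / (2 * expR M) in c0 SA *.
    have d0 : 0 < 1 + d.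
      by rewrite addr_gt0// divr_gt0// mulr_gt0// expR_gt0.
    apply: (@le_trans _ _ (expR (d / (1 + d)))); first by rewrite ler_expR.
    rewrite -[leLHS]invrK -expRN -[leRHS]invrK lef_pV2 ?posrE ?invr_gt0 ?expR_gt0//.
    apply: le_trans (expR_ge1Dx _); rewrite le_eqVlt; apply/orP; left; apply/eqP.
    by field; rewrite gt_eqF.
  lra.
rewrite (_ : p - p * q = - (p * (q - 1))); last by ring.
rewrite normrN normrM; apply: le_lt_trans (ler_pM _ _ pM q1) _ => //.
rewrite (_ : expR M * _ = e / 2); first lra.
by field; rewrite gt_eqF// expR_gt0.
Qed.

Lemma net_prodID a a1 a2 u M1 M2 :
  bounded_sums a1 (fun i => u i - 1) M1 -> bounded_sums a2 (fun i => u i - 1) M2 ->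
  (forall i, a i = a1 i || a2 i) -> (forall i, a1 i -> ~~ a2 i) ->
  net_prod a u = net_prod a1 u * net_prod a2 u.
Proof.
move=> b1 b2 aE dis; apply/cvg_lim => //.
have -> : (fun J : {fset I} => \prod_(i <- J | a i) u i) =
    (fun J : {fset I} => \prod_(i <- J | a1 i) u i * \prod_(i <- J | a2 i) u i).
  apply/funext => J; rewrite (bigID a1)/=; congr (_ * _); apply: eq_bigl => i.
    by rewrite aE; case: (a1 i); rewrite ?andbF.
  rewrite aE; case: (boolP (a1 i)) => [/dis/negbTE->|] //=.
  by rewrite andbT.
by apply: cvgM; [exact: cvg_net_prod b1|exact: cvg_net_prod b2].
Qed.

Lemma net_sumID a a1 a2 y M1 M2 :
  bounded_sums a1 y M1 -> bounded_sums a2 y M2 ->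
  (forall i, a i = a1 i || a2 i) -> (forall i, a1 i -> ~~ a2 i) ->
  net_sum a y = net_sum a1 y + net_sum a2 y.
Proof.
move=> b1 b2 aE dis; apply/cvg_lim => //.
have -> : (fun J : {fset I} => \sum_(i <- J | a i) y i) =
    (fun J : {fset I} => \sum_(i <- J | a1 i) y i + \sum_(i <- J | a2 i) y i).
  apply/funext => J; rewrite (bigID a1)/=; congr (_ + _); apply: eq_bigl => i.
    by rewrite aE; case: (a1 i); rewrite ?andbF.
  rewrite aE; case: (boolP (a1 i)) => [/dis/negbTE->|] //=.
  by rewrite andbT.
by apply: cvgD; [exact: cvg_net_sum b1|exact: cvg_net_sum b2].
Qed.

Lemma big_fset_pred1 (S : Type) (idx : S) (op : Monoid.com_law idx) (i0 : I)
    (F : I -> S) J : i0 \in J -> \big[op/idx]_(i <- J | pred1 i0 i) F i = F i0.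
Proof.
move=> iJ; rewrite big_fset_condE.
rewrite (_ : [fset i in J | pred1 i0 i]%fset = [fset i0]%fset) ?big_seq_fset1//.
by apply/fsetP => i; rewrite !inE; case: eqP => [->|]; rewrite ?iJ ?andbF.
Qed.

Lemma bounded_sums1 (i0 : I) y : bounded_sums (pred1 i0) y `|y i0|.
Proof.
move=> J; have [iJ|iJ] := boolP (i0 \in J); first by rewrite big_fset_pred1.
rewrite big_fset_condE (_ : [fset i in J | pred1 i0 i]%fset = fset0).
  by rewrite big_seq_fset0.
apply/fsetP => i; rewrite !inE; case: eqP => [->|]; rewrite ?andbF//.
by rewrite (negbTE iJ).
Qed.

Lemma net_prod1 (i0 : I) u : net_prod (pred1 i0) u = u i0.
Proof.
apply/cvg_lim => //; apply: cvg_near_cst.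
exists [fset i0]%fset => // J /=; rewrite fsub1set => iJ.
exact: big_fset_pred1.
Qed.

Lemma net_sum1 (i0 : I) y : net_sum (pred1 i0) y = y i0.
Proof.
apply/cvg_lim => //; apply: cvg_near_cst.
exists [fset i0]%fset => // J /=; rewrite fsub1set => iJ.
exact: big_fset_pred1.
Qed.

Lemma net_prod0 u : net_prod pred0 u = 1.
Proof.
apply/cvg_lim => //; apply: cvg_near_cst.
by exists fset0 => // J _; rewrite big_pred0.
Qed.

Lemma net_sum0 y : net_sum pred0 y = 0.
Proof.
apply/cvg_lim => //; apply: cvg_near_cst.
by exists fset0 => // J _; rewrite big_pred0.
Qed.

Lemma eq_net_prod a b u v : (forall i, a i = b i) -> (forall i, a i -> u i = v i) ->
  net_prod a u = net_prod b v.
Proof.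
move=> ab uv; rewrite /net_prod.
suff -> : (fun J : {fset I} => \prod_(i <- J | a i) u i) =
    (fun J : {fset I} => \prod_(i <- J | b i) v i) by [].
by apply/funext => J; exact: eq_big.
Qed.

Lemma eq_net_sum a b u v : (forall i, a i = b i) -> (forall i, a i -> u i = v i) ->
  net_sum a u = net_sum b v.
Proof.
move=> ab uv; rewrite /net_sum.
suff -> : (fun J : {fset I} => \sum_(i <- J | a i) u i) =
    (fun J : {fset I} => \sum_(i <- J | b i) v i) by [].
by apply/funext => J; exact: eq_big.
Qed.

Lemma norm_net_prodB1_le a u M : bounded_sums a (fun i => u i - 1) M ->
  `|net_prod a u - 1| <= expR M - 1.
Proof.
move=> uM; have cp := cvg_net_prod uM.
have cn : (fun J : {fset I} => `|\prod_(i <- J | a i) u i - 1|) @ totally -->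
    `|net_prod a u - 1|.
  by apply: cvg_norm; apply: cvgB => //; exact: cvg_cst.
rewrite -(cvg_lim _ cn)//; apply: limr_le; first by apply/cvg_ex; eexists; exact: cn.
apply: nearW => J.
rewrite (_ : \prod_(i <- J | a i) u i = \prod_(i <- J | a i) (1 + (u i - 1))).
  apply: le_trans (norm_prod1D_le _ _ _) _.
  by rewrite lerD2r ler_expR uM.
by apply: eq_bigr => i _; rewrite addrC subrK.
Qed.

Lemma net_sum_ge0 a y M : bounded_sums a y M -> (forall i, a i -> 0 <= y i) ->
  0 <= net_sum a y <= M.
Proof.
move=> yM y0; have cs := cvg_net_sum yM.
have ex : cvg ((fun J : {fset I} => \sum_(i <- J | a i) y i) @ totally).
  by apply/cvg_ex; eexists; exact: cs.
apply/andP; split; first by apply: limr_ge => //; apply: nearW => J; exact: sumr_ge0.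
apply: limr_le => //; apply: nearW => J; apply: le_trans (yM J).
by apply: ler_sum => i ai; exact: ler_norm.
Qed.

Lemma net_prod_squeeze a u y M M' (c d : R) : bounded_sums a y M ->
  bounded_sums a (fun i => u i - 1) M' ->
  (forall i, a i -> expR (c * y i) <= u i <= expR (d * y i)) ->
  expR (c * net_sum a y) <= net_prod a u <= expR (d * net_sum a y).
Proof.
move=> yM uM uy.
have cs := cvg_net_sum yM; have cp := cvg_net_prod uM.
have ce (k : R) : (fun J : {fset I} => expR (k * \sum_(i <- J | a i) y i)) @ totally -->
    expR (k * net_sum a y).
  by apply: continuous_cvg; [exact: continuous_expR|apply: cvgMr].
have eE (k : R) (J : {fset I}) : expR (k * \sum_(i <- J | a i) y i) =
    \prod_(i <- J | a i) expR (k * y i) by rewrite mulr_sumr expR_sum.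
rewrite -subr_ge0 -[X in _ && X]subr_ge0; apply/andP; split.
- have cd : (fun J : {fset I} => \prod_(i <- J | a i) u i -
      expR (c * \sum_(i <- J | a i) y i)) @ totally -->
      net_prod a u - expR (c * net_sum a y) by exact: cvgB.
  rewrite -(cvg_lim _ cd)//; apply: limr_ge; first by apply/cvg_ex; eexists; exact: cd.
  apply: nearW => J; rewrite subr_ge0 /= eE; apply: ler_prod => i /uy /andP[-> _].
  by rewrite expR_ge0.
- have cd : (fun J : {fset I} => expR (d * \sum_(i <- J | a i) y i) -
      \prod_(i <- J | a i) u i) @ totally -->
      expR (d * net_sum a y) - net_prod a u by exact: cvgB.
  rewrite -(cvg_lim _ cd)//; apply: limr_ge; first by apply/cvg_ex; eexists; exact: cd.
  apply: nearW => J; rewrite subr_ge0 /= eE; apply: ler_prod => i /uy /andP[h ->].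
  by rewrite (le_trans _ h)// expR_ge0.
Qed.

End unordered_products.
(** * The finite variation factor of the exponential *)

Section compensated_jumps.
Context {R : realType}.
Variables (Pi : nat -> nat -> R) (X : R -> R).
Hypothesis Pi_partition : forall n, is_partition (Pi n).
Hypothesis X_QV : QV Pi X.
Implicit Types (a : pred R) (s t u v x T : R).

Let Q := qv Pi X.
Let C := continuous_part Q.
Let Qc : cadlag Q. Proof. by case: X_QV. Qed.
Let Qm s t : 0 <= s -> s <= t -> Q s <= Q t.
Proof. exact: (qv_homo X_QV). Qed.

Let sqj v := jump X v ^+ 2.

Definition jump_factor v := (1 + jump X v) * expR (- jump X v).

Lemma jump_qv v : 0 < v -> jump Q v = sqj v.
Proof. by move=> v0; have [_ _ _ _ /(_ v (ltW v0))] := X_QV. Qed.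

Lemma le_left_lim_qv s u : 0 <= s -> s < u -> Q s <= left_lim Q u.
Proof.
move=> s0 su; have u0 := le_lt_trans s0 su.
have Ql := cadlag_cvg_left Qc u0.
rewrite -(cvg_lim _ Ql)//; apply: limr_ge; first by apply/cvg_ex; eexists; exact: Ql.
apply/near_leftP; exists (u - s); first by rewrite subr_gt0.
by move=> x /andP[sx _]; apply: Qm => //; lra.
Qed.

(** Each squared jump is a jump of [X, X], hence at most the increment of the
    increasing function [X, X] since the previous point of l. *)
Lemma sum_jumps_path (l : seq R) s : 0 <= s -> path <%R s l ->
  \sum_(v <- l) sqj v <= Q (last s l) - Q s.
Proof.
elim: l s => [|v l IH] s s0 /=; first by rewrite big_nil subrr.
move=> /andP[sv vl]; rewrite big_cons.
have v0 := le_lt_trans s0 sv.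
have := IH v (ltW v0) vl; have := le_left_lim_qv s0 sv.
rewrite -jump_qv// /jump; lra.
Qed.

Lemma bounded_sums_jumps a s (B : R) : 0 <= s -> (forall v, a v -> s < v) ->
  Q s <= B -> (forall v, a v -> Q v <= B) -> bounded_sums a sqj (B - Q s).
Proof.
move=> s0 as_ sB aB J.
pose l := sort <=%R [seq v <- J | a v].
have la v : v \in l -> a v by rewrite mem_sort mem_filter => /andP[].
have pl : path <%R s l.
  rewrite lt_path_sortedE sort_lt_sorted filter_uniq ?fset_uniq// andbT.
  by apply/allP => v /la /as_.
have -> : \sum_(v <- J | a v) `|sqj v| = \sum_(v <- l) sqj v.
  have -> : \sum_(v <- l) sqj v = \sum_(v <- [seq v <- J | a v]) sqj v.
    by apply: perm_big; rewrite perm_sort.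
  rewrite big_filter.
  by apply: eq_bigr => v _; rewrite ger0_norm ?sqr_ge0.
apply: le_trans (sum_jumps_path s0 pl) _; rewrite lerD2r.
by have := mem_last s l; rewrite in_cons => /orP[/eqP ->|/la/aB].
Qed.

Lemma bounded_jumps s t : 0 <= s -> s <= t ->
  bounded_sums (fun v => s < v <= t) sqj (Q t - Q s).
Proof.
move=> s0 st; apply: bounded_sums_jumps => //.
- by move=> v /andP[].
- exact: Qm.
- by move=> v /andP[sv vt]; apply: Qm => //; exact: le_trans (ltW sv).
Qed.

Lemma bounded_jumps_open s u : 0 <= s -> s < u ->
  bounded_sums (fun v => s < v < u) sqj (Q u - Q s - sqj u).
Proof.
move=> s0 su; have u0 := le_lt_trans s0 su.
rewrite (_ : Q u - Q s - sqj u = left_lim Q u - Q s); last first.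
  by rewrite -jump_qv// /jump; ring.
apply: bounded_sums_jumps => //.
- by move=> v /andP[].
- exact: le_left_lim_qv.
- by move=> v /andP[sv vu]; apply: le_left_lim_qv => //; exact: le_trans (ltW sv).
Qed.

(** A constant for jump_factor_bound valid up to time T, as each squared jump
    is at most the increment of [X, X]. *)
Definition jump_constant T := 1 + expR (1 + (Q T - Q 0)).

Lemma jump_constant_ge0 T : 0 <= jump_constant T.
Proof. by rewrite addr_ge0// expR_ge0. Qed.

Lemma bounded_jump_factor a T (M : R) : (forall v, a v -> 0 < v <= T) ->
  bounded_sums a sqj M ->
  bounded_sums a (fun v => jump_factor v - 1) (jump_constant T * M).
Proof.
move=> aT aM J; apply: (@le_trans _ _ (jump_constant T * \sum_(v <- J | a v) `|sqj v|)).
  rewrite mulr_sumr; apply: ler_sum => v /aT /andP[v0 vT].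
  rewrite [ `|sqj v|]ger0_norm ?sqr_ge0//; apply: jump_factor_bound.
  have : sqj v <= Q T - Q 0.
    have h1 := le_left_lim_qv (lexx 0) v0; have h2 := Qm (ltW v0) vT.
    rewrite -jump_qv// /jump; lra.
  rewrite /sqj -(real_normK (num_real (jump X v))).
  move: (normr_ge0 (jump X v)); move: `|jump X v| => y; nra.
by rewrite ler_wpM2l ?jump_constant_ge0.
Qed.

Let in0T s t T : 0 <= s -> t <= T -> forall v, s < v <= t -> 0 < v <= T.
Proof.
move=> s0 tT v /andP[sv vt]; rewrite (le_lt_trans s0 sv)/=; exact: le_trans tT.
Qed.

Definition jump_prod s t := net_prod (fun v => s < v <= t) jump_factor.

Definition jump_sum s t := net_sum (fun v => s < v <= t) sqj.

Lemma interval_split s u t v : s <= u -> u <= t ->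
  (s < v <= t) = (s < v <= u) || (u < v <= t).
Proof.
move=> su ut; apply/idP/idP => [/andP[sv vt]|/orP[/andP[sv vu]|/andP[uv vt]]].
- by rewrite sv vt/= andbT; case: leP.
- by rewrite sv (le_trans vu).
- by rewrite vt (le_lt_trans su).
Qed.

Lemma interval_disjoint s u t v : s < v <= u -> ~~ (u < v <= t).
Proof. by move=> /andP[_ vu]; rewrite ltNge vu. Qed.

Lemma jump_prod_split s u t : 0 <= s -> s <= u -> u <= t ->
  jump_prod s t = jump_prod s u * jump_prod u t.
Proof.
move=> s0 su ut; have u0 := le_trans s0 su.
have b1 := bounded_jump_factor (in0T s0 ut) (bounded_jumps s0 su).
have b2 := bounded_jump_factor (in0T u0 (lexx t)) (bounded_jumps u0 ut).
apply: (net_prodID b1 b2) => v; first exact: interval_split.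
exact: interval_disjoint.
Qed.

Lemma jump_sum_split s u t : 0 <= s -> s <= u -> u <= t ->
  jump_sum s t = jump_sum s u + jump_sum u t.
Proof.
move=> s0 su ut; have u0 := le_trans s0 su.
apply: (net_sumID (bounded_jumps s0 su) (bounded_jumps u0 ut)) => v.
  exact: interval_split.
exact: interval_disjoint.
Qed.

(** Both terms of the continuous part are additive over intervals. *)
Lemma continuous_part_incr s t : 0 <= s -> s <= t ->
  C t - C s = Q t - Q s - jump_sum s t.
Proof.
move=> s0 st.
have sumE r : sum_upto (jump Q) r = jump_sum 0 r.
  by apply: eq_net_sum => // v /andP[v0 _]; exact: jump_qv.
rewrite /C /continuous_part !sumE (jump_sum_split (lexx 0) s0 st); ring.
Qed.

Lemma jump_sum_bounds s t : 0 <= s -> s <= t -> 0 <= jump_sum s t <= Q t - Q s.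
Proof.
move=> s0 st; apply: (net_sum_ge0 (bounded_jumps s0 st)) => v _; exact: sqr_ge0.
Qed.

(** The factor by which exp(- [X, X]^c / 2) times the jump product grows over
    ]s, t]: the part of finite variation of the exponential, without exp X. *)
Definition weight_ratio s t := jump_prod s t * expR (- (2^-1 * (C t - C s))).

Lemma weight_ratio_bound T : 0 <= T -> exists2 c, 0 <= c &
  forall s t, 0 <= s -> s <= t -> t <= T ->
    `|weight_ratio s t - 1| <= c * (Q t - Q s).
Proof.
move=> T0; pose K := jump_constant T.
have K0 : 0 <= K by exact: jump_constant_ge0.
exists (K * expR (K * (Q T - Q 0)) + 1).
  by rewrite addr_ge0// mulr_ge0// expR_ge0.
move=> s t s0 st tT; set h := Q t - Q s.
have h0 : 0 <= h by rewrite subr_ge0 Qm.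
have hT : h <= Q T - Q 0.
  by rewrite lerB// ?Qm// (le_trans s0).
have d_bounds : 0 <= C t - C s <= h.
  have := jump_sum_bounds s0 st; rewrite -/h => /andP[? ?].
  by rewrite continuous_part_incr// -/h; apply/andP; split; lra.
have /andP[d0 dh] := d_bounds.
have pb : `|jump_prod s t - 1| <= expR (K * h) - 1.
  exact: norm_net_prodB1_le (bounded_jump_factor (in0T s0 tT) (bounded_jumps s0 st)).
apply: le_trans (mul_expRN_dist1_le pb d0 dh) _.
by rewrite [leRHS]mulrDl mul1r lerD2r expRB1_mul_le.
Qed.

(** Just before u the jumps of X and the increments of [X, X]^c fade out; the
    jump at u itself remains. *)
Lemma weight_ratio_left u : 0 < u ->
  weight_ratio x u @[x --> u^'-] --> jump_factor u.
Proof.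
move=> u0; pose K := jump_constant u.
have K0 : 0 <= K by exact: jump_constant_ge0.
pose eta x := Q u - Q x - sqj u.
have eta0 : eta x @[x --> u^'-] --> 0.
  apply: (@cvg_to0 _ _ _ _ eta (Q u - left_lim Q u - sqj u)) => //.
    by rewrite -jump_qv// /jump subrr.
  have Ql := cadlag_cvg_left Qc u0.
  have c (a : R) : a @[_ --> u^'-] --> a by exact: cvg_cst.
  by apply: cvgB => //; exact: cvgB.
pose B x := `|jump_factor u| * (expR (K * eta x) - 1 + eta x).
have B0 : B x @[x --> u^'-] --> 0.
  apply: (@cvg_to0 _ _ _ _ B (`|jump_factor u| * (expR (K * 0) - 1 + 0))) => //.
    by rewrite mulr0 expR0 subrr addr0 mulr0.
  apply: cvgMr; apply: cvgD => //; apply: cvgB; last exact: cvg_cst.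
  by apply: continuous_cvg; [exact: continuous_expR|exact: cvgMr].
apply/cvgrPdist_le => e e0; have /cvgr0Pnorm_le/(_ e e0) Be := B0.
near=> x.
have x0 : 0 <= x by near: x; apply: nbhs_left_ge.
have xu : x < u by near: x; exact: nbhs_left_lt.
have : `|B x| <= e by near: x.
apply: le_trans; apply: le_trans (ler_norm _).
have bo := bounded_jumps_open x0 xu.
have sub v : x < v < u -> 0 < v <= u.
  by move=> /andP[xv vu]; rewrite (le_lt_trans x0 xv) ltW.
have bof := bounded_jump_factor sub bo.
have spl v : (x < v <= u) = (x < v < u) || (v == u).
  by rewrite le_eqVlt; case: (eqVneq v u) => [->|_]; rewrite ?xu ?orbT ?orbF ?andbT.
have dis v : x < v < u -> ~~ (v == u).
  by move=> /andP[_ vu]; rewrite lt_eqF.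
have bs1 := bounded_sums1 u sqj.
have sub1 v : pred1 u v -> 0 < v <= u by move=> /eqP ->; rewrite u0 lexx.
have pE : jump_prod x u = net_prod (fun v => x < v < u) jump_factor * jump_factor u.
  rewrite -(net_prod1 u jump_factor).
  exact: (net_prodID bof (bounded_jump_factor sub1 bs1)).
have sE : jump_sum x u = net_sum (fun v => x < v < u) sqj + sqj u.
  rewrite -(net_sum1 u sqj); exact: (net_sumID bo bs1).
have /andP[so0 _] := net_sum_ge0 bo (fun v _ => sqr_ge0 (jump X v)).
have eta_ge : C u - C x <= eta x.
  by rewrite continuous_part_incr ?(ltW xu)// sE /eta; lra.
have d0 : 0 <= C u - C x.
  have /andP[_ ?] := jump_sum_bounds x0 (ltW xu).
  by rewrite continuous_part_incr ?(ltW xu)//; lra.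
have := mul_expRN_dist1_le (norm_net_prodB1_le bof) d0 eta_ge.
rewrite /weight_ratio pE; set E := expR (- _); set p := net_prod _ _ => h.
rewrite (_ : jump_factor u - _ = - (jump_factor u * (p * E - 1))); last by ring.
by rewrite normrN normrM /B ler_wpM2l.
Unshelve. all: by end_near. Qed.

(** Away from large jumps the ratio is exp(- ([X, X]_t - [X, X]_s) / 2) up to
    second order: the continuous part contributes its increment and each jump
    its square, by jump_factor_squeeze. Times exp(X_t - X_s), this gives the
    second order expansion of the exponential over [s, t]. *)
Lemma weight_ratio_small (e : R) : 0 < e -> exists2 eta, 0 < eta &
  forall s t, 0 <= s -> s <= t ->
    (forall v, s < v <= t -> `|jump X v| <= eta) ->
    `|X t - X s| <= eta -> Q t - Q s <= eta ->
    `|weight_ratio s t * expR (X t - X s) - 1 - (X t - X s) -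
      2^-1 * (sq_incr X s t - (Q t - Q s))| <=
    e * (sq_incr X s t + (Q t - Q s)).
Proof.
move=> e0; pose d := Num.min (e / 7) 2^-1.
have d0 : 0 < d by rewrite lt_min divr_gt0//= invr_gt0.
have [de d12] : d <= e / 7 /\ d <= 2^-1 by rewrite /d !ge_min !lexx orbT.
exists (d / 6) => [|s t s0 st js]; first by rewrite divr_gt0.
rewrite /sq_incr; set x := X t - X s; set h := Q t - Q s => xd hd.
have h0 : 0 <= h by rewrite subr_ge0 Qm.
have /andP[S0 Sh] := jump_sum_bounds s0 st.
have bj := bounded_jumps s0 st.
have bf := bounded_jump_factor (in0T s0 (lexx t)) bj.
have CE := continuous_part_incr s0 st; rewrite -/h in Sh CE.
have wh : `|weight_ratio s t - 1 + 2^-1 * h| <= 3 * d * h.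
  apply: expR_half_between => //; first lra.
  have /andP[p1 p2] := net_prod_squeeze bj bf
    (fun v sv => jump_factor_squeeze d0 d12 (js v sv)).
  rewrite -/(jump_sum s t) -/(jump_prod s t) in p1 p2.
  have split k : expR (- k * h) = expR (- k * jump_sum s t) * expR (- k * (C t - C s)).
    by rewrite -expRD; congr expR; rewrite CE; ring.
  have D0 : 0 <= C t - C s by rewrite CE subr_ge0.
  rewrite !split /weight_ratio; apply/andP; split; apply: ler_pM; rewrite ?expR_ge0 //.
  - rewrite ler_expR; nra.
  - by rewrite (le_trans _ p1)// expR_ge0.
  - rewrite ler_expR; nra.
have x12 : `|x| <= 2^-1 by lra.
have t2 := expR_taylor2 x12; have t1 := expR_ltD1sq x12.
have x2 : x ^+ 2 = `|x| ^+ 2 by rewrite real_normK ?num_real.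
have ex1 : `|expR x - 1| <= 2 * d.
  rewrite (_ : expR x - 1 = (expR x - 1 - x) + x); last by ring.
  apply: le_trans (ler_normD _ _) _; rewrite x2 in t1.
  move: (normr_ge0 x) t1 xd x12; move: `|x| => y; nra.
have ex2 : `|expR x| <= 2.
  have := ler_normD (expR x - 1) 1; rewrite subrK normr1; lra.
have h3 : 2 * `|x| ^+ 3 <= 2 * d * x ^+ 2.
  have xd' : `|x| <= d by lra.
  rewrite x2 exprS mulrA; apply: ler_wpM2r; first by rewrite exprn_ge0.
  by rewrite ler_pM2l.
set w := weight_ratio s t in wh *.
rewrite (_ : w * expR x - 1 - x - 2^-1 * (x ^+ 2 - h) =
  (w - 1 + 2^-1 * h) * expR x - 2^-1 * h * (expR x - 1) +
  (expR x - 1 - x - 2^-1 * x ^+ 2)); last by ring.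
apply: le_trans (ler_normD _ _) _.
have := ler_normB ((w - 1 + 2^-1 * h) * expR x) (2^-1 * h * (expR x - 1)).
rewrite !normrM (ger0_norm h0) [ `|2^-1|]ger0_norm ?invr_ge0//.
have m1 : `|w - 1 + 2^-1 * h| * `|expR x| <= 3 * d * h * 2.
  by rewrite ler_pM.
have m2 : 2^-1 * h * `|expR x - 1| <= 2^-1 * h * (2 * d).
  by apply: ler_wpM2l => //; rewrite mulr_ge0.
have m3 : 7 * d * (x ^+ 2 + h) <= e * (x ^+ 2 + h).
  apply: ler_wpM2r; last lra.
  by apply: addr_ge0 => //; exact: sqr_ge0.
have m4 : 0 <= d * x ^+ 2 by apply: mulr_ge0; [exact: ltW|exact: sqr_ge0].
lra.
Qed.

End compensated_jumps.
(** * Admissibility of the exponential *)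

Section cadlag_bounds.
Context {R : realType}.
Implicit Types (A X Q : R -> R) (T s t : R).

Lemma cadlag_bounded X t : cadlag X -> 0 <= t ->
  exists M, forall s, 0 <= s -> s <= t -> `|X s| <= M.
Proof.
move=> Xc; move: t; apply: real_induction.
- exists `|X 0| => s s0 s0'.
  by have -> : s = 0 by apply/le_anti; rewrite s0 s0'.
- move=> u u0 [M HM]; have [d d0 Xd] := cadlag_right Xc u0 ltr01.
  exists d => // t /andP[ut td]; exists (Num.max M (`|X u| + 1)) => s s0 st.
  have [su|us] := leP s u; first by rewrite le_max HM.
  rewrite le_max; apply/orP; right.
  have : `|X s - X u| <= 1 by apply: Xd; rewrite ltW//= (le_lt_trans st).
  by have := lerB_dist (X s) (X u); lra.
- move=> u u0 HM; have [d d0 Xd] := cadlag_left Xc u0 ltr01.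
  pose t := Num.max 0 (u - d).
  have tu : t < u by rewrite gt_max u0/=; lra.
  have t0 : 0 <= t by rewrite le_max lexx.
  have dt : u - d <= t by rewrite le_max lexx orbT.
  have [M HtM] : exists M, forall s, 0 <= s -> s <= t -> `|X s| <= M.
    by apply: HM; rewrite t0.
  exists (Num.max M (Num.max (`|left_lim X u| + 1) `|X u|)) => s s0 su.
  have [st|ts] := leP s t; first by rewrite le_max HtM.
  move: su; rewrite le_eqVlt => /orP[/eqP ->|su]; first by rewrite !le_max lexx !orbT.
  rewrite !le_max; apply/orP; right; apply/orP; left.
  have : `|X s - left_lim X u| <= 1 by apply: Xd; rewrite su (le_lt_trans dt).
  by have := lerB_dist (X s) (left_lim X u); lra.
Qed.

(** Domination by the increments of a cadlag function gives the Cauchy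
    criterion on the left. *)
Lemma dominated_cadlag A Q : cadlag Q ->
  (forall T, 0 <= T -> exists2 c, 0 <= c & forall s t, 0 <= s -> s <= t -> t <= T ->
     `|A t - A s| <= c * (Q t - Q s)) ->
  cadlag A.
Proof.
move=> Qc AQ; split=> u u0.
  have u10 : 0 <= u + 1 by lra.
  have [c c0 Ac] := AQ (u + 1) u10.
  apply/cvgrPdist_le => e e0; apply/near_rightP.
  have ec0 : 0 < e / (c + 1) by rewrite divr_gt0// ltr_wpDl.
  have [d d0 Qd] := cadlag_right Qc u0 ec0.
  exists (Num.min d 1); first by rewrite lt_min d0 ltr01.
  move=> s /andP[us]; rewrite -ltrBlDl lt_min => /andP[sd s1].
  have us' := ltW us.
  rewrite distrC; apply: le_trans (Ac u s u0 us' _) _; first lra.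
  apply: le_trans (mulr_div_succ_le c0 (ltW e0)); apply: ler_wpM2l => //.
  by apply: le_trans (ler_norm _) _; apply: Qd; apply/andP; split; lra.
have [c c0 Ac] := AQ u (ltW u0).
have Acauchy : cauchy_ex (A s @[s --> u^'-]).
  move=> e e0; have e20 : 0 < e / 2 by rewrite divr_gt0.
  have ec0 : 0 < e / 2 / (c + 1) by rewrite divr_gt0// ltr_wpDl.
  have [d d0 Qd] := cadlag_left_osc Qc u0 ec0.
  have [x [x0 xd xu]] := left_approach u0 d0.
  exists (A x); apply/near_leftP; exists (u - x); first by rewrite subr_gt0.
  move=> s /andP[xs su]; have {}xs : x < s by lra.
  rewrite /= /ball/= distrC; apply: le_lt_trans (Ac x s x0 (ltW xs) (ltW su)) _.
  have : c * (Q s - Q x) <= e / 2.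
    apply: le_trans (mulr_div_succ_le c0 (ltW e20)); apply: ler_wpM2l => //.
    by apply: le_trans (ler_norm _) _; apply: Qd; rewrite ?xd ?xu ?su ?(lt_trans xd).
  lra.
exact: (cauchy_cvg _ (cauchy_exP _ Acauchy)).
Qed.

End cadlag_bounds.

Section exponential_integrand.
Context {R : realType}.
Implicit Types (p v : 'rV[R]_1 * R).

(** The exponential is f_x(W, X) for this f, which equals its own
    x-derivative, W being doleans_weight. *)
Definition exp_primitive p : R := p.1 0 0 * expR p.2.

Lemma is_derive_of_line {V : normedModType R} (f : V -> R) (p v : V) (d : R) :
  is_derive (0 : R) 1 (fun z : R => f (p + z *: v)) d -> is_derive p v f d.
Proof.
have E : (fun h => h^-1 *: (((fun z : R => f (p + z *: v)) \o shift 0) (h *: 1%R)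
    - f (p + 0 *: v))) =
  (fun h => h^-1 *: ((f \o shift p) (h *: v) - f p)).
  apply/funext => h /=; rewrite scale0r !addr0; congr (_ *: (f _ - _)).
  by rewrite [h *: 1]mulr1 addrC.
by case; rewrite /derivable /derive /= E => ? ?; split.
Qed.

Lemma exp_primitive_dir_x p : is_derive p dir_x exp_primitive (exp_primitive p).
Proof.
apply: is_derive_of_line.
rewrite (_ : (fun z : R => _) = fun z => p.1 0 0 * expR (p.2 + z)); last first.
  apply/funext => z; rewrite /exp_primitive /= [z *: 1]mulr1; congr (_ * _).
  by rewrite scaler0 addr0.
apply: is_derive_eq; rewrite addr0 /exp_primitive /GRing.scale/=; ring.
Qed.

Lemma exp_primitive_dir_a p i : is_derive p (dir_a i) exp_primitive (expR p.2).
Proof.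
apply: is_derive_of_line.
rewrite (_ : (fun z : R => _) = fun z => (p.1 0 0 + z) * expR p.2); last first.
  apply/funext => z; rewrite /exp_primitive /= scaler0 addr0; congr (_ * _).
  by rewrite (ord1 i) !mxE eqxx mulr1.
apply: is_derive_eq; rewrite /GRing.scale/=; ring.
Qed.

Lemma continuous_exp_primitive : continuous exp_primitive.
Proof.
move=> p; apply: cvgM.
  apply: (@continuous_comp _ _ _ fst (fun a : 'rV[R]_1 => a 0 0)).
    exact: cvg_fst.
  exact: coord_continuous.
by apply: (@continuous_comp _ _ _ snd expR); [exact: cvg_snd|exact: continuous_expR].
Qed.

Lemma C12_exp_primitive : C12_on setT exp_primitive.
Proof.
have Dx : 'D_dir_x exp_primitive = exp_primitive.
  by apply/funext => p; case: (exp_primitive_dir_x p).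
have Da i : 'D_(dir_a i) exp_primitive = (fun p => expR p.2).
  by apply/funext => p; case: (exp_primitive_dir_a p i).
move=> p _; have [dx _] := exp_primitive_dir_x p.
have cx : {for p, continuous ('D_dir_x exp_primitive)}.
  apply: (eq_ind_r (fun g : _ -> R => {for p, continuous g}) _ Dx).
  exact: continuous_exp_primitive.
have cxx : {for p, continuous ('D_dir_x ('D_dir_x exp_primitive))}.
  exact: (eq_ind_r (fun g : _ -> R => {for p, continuous ('D_dir_x g)}) cx Dx).
have dxx : derivable ('D_dir_x exp_primitive) p dir_x.
  exact: (eq_ind_r (fun g : _ -> R => derivable g p dir_x) dx Dx).
have ca i : {for p, continuous ('D_(dir_a i) exp_primitive)}.
  apply: (eq_ind_r (fun g : _ -> R => {for p, continuous g}) _ (Da i)).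
  by apply: (@continuous_comp _ _ _ snd expR); [exact: cvg_snd|exact: continuous_expR].
split; [move=> i|exact: (conj dx cx)|exact: (conj dxx cxx)].
by have [da _] := exp_primitive_dir_a p i; exact: (conj da (ca i)).
Qed.

Lemma bounded_relatively_compact (K : set ('rV[R]_1 * R)) (M : R) :
  (forall p, K p -> `|p.1 0 0| <= M /\ `|p.2| <= M) ->
  relatively_compact_in setT K.
Proof.
move=> KM; split=> //; rewrite setIT.
pose A := [set a : 'rV[R]_1 | forall i, `[- M, M]%classic (a ord0 i)].
have Ac : compact A.
  by apply: (@rV_compact _ _ (fun=> `[- M, M]%classic)) => _; exact: segment_compact.
have Bc : compact (A `*` `[- M, M]%classic).
  by apply: compact_setX => //; exact: segment_compact.
apply: (subclosed_compact _ Bc); first exact: closed_closure.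
have Bcl : closed (A `*` `[- M, M]%classic).
  by apply: (compact_closed _ Bc); exact: norm_hausdorff.
move: (closure_id (A `*` `[- M, M]%classic)) => [+ _] => /(_ Bcl) ->.
apply: closureS => p /KM [p1 p2]; split=> /=.
  by move=> i; rewrite (ord1 i) /= in_itv/= -ler_norml.
by rewrite in_itv/= -ler_norml.
Qed.

End exponential_integrand.

(** * The exponential solves the equation *)

Section existence.
Context {R : realType}.
Variables (Pi : nat -> nat -> R) (X : R -> R).
Hypothesis Pi_partition : forall n, is_partition (Pi n).
Hypothesis Pi_mesh : mesh (Pi n) @[n --> \oo] --> 0%E.
Hypothesis X_QV : QV Pi X.
Implicit Types (s t u v x y T : R).

Let Q := qv Pi X.
Let C := continuous_part Q.
Let Z := doleans_dade Pi X.
Let Xc : cadlag X. Proof. by case: X_QV. Qed.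
Let Qc : cadlag Q. Proof. by case: X_QV. Qed.
Let Qm s t : 0 <= s -> s <= t -> Q s <= Q t.
Proof. exact: (qv_homo X_QV). Qed.

Let w := weight_ratio Pi X.

(** The exponential divided by exp X. It has locally finite variation. *)
Definition doleans_weight t :=
  expR (- X 0 - 2^-1 * C t) * prod_upto (jump_factor X) t.

Let W := doleans_weight.

Lemma doleans_dadeE t : Z t = W t * expR (X t).
Proof.
rewrite /Z /doleans_dade /W /doleans_weight mulrAC -expRD.
by congr (expR _ * _); rewrite -/Q -/C; ring.
Qed.

Lemma doleans_weight_ratio s t : 0 <= s -> s <= t -> W t = W s * w s t.
Proof.
move=> s0 st; rewrite /W /doleans_weight /w /weight_ratio.
have -> : prod_upto (jump_factor X) t =
    prod_upto (jump_factor X) s * jump_prod X s t.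
  exact: (jump_prod_split X_QV (lexx 0) s0 st).
rewrite -/Q -/C.
have -> : - X 0 - 2^-1 * C t = (- X 0 - 2^-1 * C s) + - (2^-1 * (C t - C s)).
  by field.
by rewrite expRD; ring.
Qed.

Lemma doleans_weight_dominated T : 0 <= T -> exists2 c, 0 <= c &
  forall s t, 0 <= s -> s <= t -> t <= T -> `|W t - W s| <= c * (Q t - Q s).
Proof.
move=> T0; have [c c0 wc] := weight_ratio_bound X_QV T0.
pose B := `|W 0| * (1 + c * (Q T - Q 0)).
have WB s : 0 <= s -> s <= T -> `|W s| <= B.
  move=> s0 sT; rewrite (doleans_weight_ratio (lexx 0) s0) normrM ler_wpM2l//.
  have h1 := wc 0 s (lexx 0) s0 sT.
  have h2 : c * (Q s - Q 0) <= c * (Q T - Q 0) by rewrite ler_wpM2l// lerD2r Qm.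
  have := ler_normD (w 0 s - 1) 1; rewrite subrK normr1; rewrite -/w in h1.
  rewrite -/Q in h1; lra.
have B0 : 0 <= B by rewrite (le_trans _ (WB 0 _ _)).
exists (B * c) => [|s t s0 st tT]; first by rewrite mulr_ge0.
rewrite (doleans_weight_ratio s0 st).
rewrite (_ : _ - _ = W s * (w s t - 1)); last by ring.
rewrite normrM -mulrA ler_pM//; first by rewrite WB// (le_trans st).
exact: wc.
Qed.

Lemma doleans_weight_FV : FV_loc W.
Proof.
split; first exact: dominated_cadlag Qc doleans_weight_dominated.
move=> T T0; have [c c0 Wc] := doleans_weight_dominated (ltW T0).
apply: (@bounded_variation_le _ T W (fun t => c * Q t) T0) => s t s0 st tT.
by rewrite -mulrBr; exact: Wc.
Qed.

Lemma doleans_dade_cadlag : cadlag Z.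
Proof.
have -> : Z = (fun t => W t * expR (X t)) by apply/funext => t; rewrite doleans_dadeE.
apply: cadlagM; first by case: doleans_weight_FV.
exact: cadlag_expR.
Qed.

Lemma doleans_dade_admissible : admissible_integrand X Z.
Proof.
split; first exact: doleans_dade_cadlag.
move=> T T0.
exists 1%N, setT, exp_primitive, (fun=> W); split.
- exact: openT.
- exact: C12_exp_primitive.
- by move=> _; exact: doleans_weight_FV.
- move=> t _; have [_ ->] := exp_primitive_dir_x ((\row__ W t, X t) : 'rV[R]_1 * R).
  by rewrite /exp_primitive/= mxE doleans_dadeE.
- have [M1 HM1] := cadlag_bounded doleans_weight_FV.1 (ltW T0).
  have [M2 HM2] := cadlag_bounded Xc (ltW T0).
  apply: (@bounded_relatively_compact _ _ (Num.max M1 M2)) => _ [t /= + <-] /=.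
  rewrite in_itv/= mxE => /andP[t0 tT].
  by rewrite !le_max HM1// HM2// orbT.
Qed.

Lemma doleans_dade_start : Z 0 = 1.
Proof.
have Q0 : Q 0 = 0.
  rewrite /Q /qv; apply/cvg_lim => //.
  rewrite (_ : (fun n => _) = fun=> 0); first exact: cvg_cst.
  by apply/funext => n; rewrite qv_sumE// psumxx.
have no v : (0 < v <= (0 : R)) = false.
  by apply/negP => /andP[v0 v1]; move: (lt_le_trans v0 v1); rewrite ltxx.
rewrite /Z /doleans_dade /continuous_part -/Q Q0.
have -> : sum_upto (jump Q) 0 = 0.
  by rewrite -[RHS](net_sum0 (jump Q)); apply: eq_net_sum.
rewrite subrr !subr0 mulr0 subr0 expR0 mul1r.
by rewrite -[RHS](net_prod0 (jump_factor X)); apply: eq_net_prod.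
Qed.

Lemma linear_error_doleans_dade s t : 0 <= s -> s <= t ->
  linear_error X Z s t =
  Z s * (w s t * expR (X t - X s) - 1 - (X t - X s)).
Proof.
move=> s0 st; rewrite /linear_error !doleans_dadeE (doleans_weight_ratio s0 st).
have -> : expR (X t) = expR (X t - X s) * expR (X s) by rewrite -expRD subrK.
by ring.
Qed.

(** The exponential jumps as a solution should:
    (1 + z) exp(- z) * exp z - 1 - z = 0 for the jump z of X. *)
Lemma doleans_dade_vanishes_left T : vanishes_left T (linear_error X Z).
Proof.
apply: cvg_vanishes_left => u u0 _.
have Zl := cadlag_cvg_left doleans_dade_cadlag u0.
have Xl := cadlag_cvg_left Xc u0.
have wl := weight_ratio_left X_QV u0.
have c (a : R) : a @[_ --> u^'-] --> a by exact: cvg_cst.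
have l0 : left_lim Z u * (jump_factor X u * expR (X u - left_lim X u) - 1 -
    (X u - left_lim X u)) = 0.
  by rewrite /jump_factor -/(jump X u) -mulrA [expR (- _) * _]mulrC expRxMexpNx_1; ring.
rewrite -l0; apply: (@cvg_trans _ ((Z x * (w x u * expR (X u - X x) - 1 -
    (X u - X x))) @[x --> u^'-])).
  apply: near_eq_cvg; near=> x.
  have x0 : 0 <= x by near: x; apply: nbhs_left_ge.
  have xu : x <= u by near: x; exact: nbhs_left_le.
  by rewrite linear_error_doleans_dade.
apply: cvgM => //; apply: cvgB; last exact: cvgB.
apply: cvgB => //; apply: cvgM => //.
by apply: continuous_cvg; [exact: continuous_expR|exact: cvgB].
Unshelve. all: by end_near. Qed.

Lemma jump_le_oscillation (e u d : R) : 0 <= u ->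
  (forall x y, u <= x < u + d -> u <= y < u + d -> `|X y - X x| <= e) ->
  forall v, u < v < u + d -> `|jump X v| <= e.
Proof.
move=> u0 Xd v /andP[uv vd]; have v0 := le_lt_trans u0 uv.
have cj : (`|X v - X x|) @[x --> v^'-] --> `|jump X v|.
  by apply: cvg_norm; apply: cvgB; [exact: cvg_cst|exact: cadlag_cvg_left].
rewrite -(cvg_lim _ cj)//; apply: limr_le; first by apply/cvg_ex; eexists; exact: cj.
apply/near_leftP; exists (v - u); first by rewrite subr_gt0.
by move=> x /andP[xu xv]; apply: Xd; apply/andP; split; lra.
Qed.

(** Locally the Euler error of the exponential Z is Z / 2 times
    (X_t - X_s)^2 - ([X, X]_t - [X, X]_s), whose sums vanish in the limit. *)
Lemma doleans_dade_local (e z B : R) : 0 < e -> 0 < B -> exists2 eta, 0 < eta &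
  forall s t, 0 <= s -> s <= t ->
    (forall v, s < v <= t -> `|jump X v| <= eta) ->
    `|X t - X s| <= eta -> Q t - Q s <= eta ->
    `|Z s| <= B -> `|Z s - z| <= e ->
    `|linear_error X Z s t - 2^-1 * z * (sq_incr X s t - (Q t - Q s))| <=
    e * (sq_incr X s t + (Q t - Q s)).
Proof.
move=> e0 B0; have e2B : 0 < e / 2 / B by rewrite !divr_gt0.
have [eta eta0 H] := weight_ratio_small X_QV e2B.
exists eta => // s t s0 st js xs qs ZB Zz.
have := H s t s0 st js xs qs.
rewrite linear_error_doleans_dade// -/w -/Q.
set q := sq_incr X s t - _; set m := sq_incr X s t + _.
set D := X t - X s; set E := w s t * expR D.
have m0 : 0 <= m by rewrite addr_ge0 ?sqr_ge0// subr_ge0 Qm.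
have qm : `|q| <= m.
  by apply: le_trans (ler_normB _ _) _; rewrite !ger0_norm ?sqr_ge0 ?subr_ge0 ?Qm.
move=> h.
rewrite (_ : _ - _ = Z s * (E - 1 - D - 2^-1 * q) + 2^-1 * ((Z s - z) * q)); last by ring.
apply: le_trans (ler_normD _ _) _.
rewrite (normrM (Z s)) (normrM 2^-1) (normrM (Z s - z)).
rewrite [ `|2^-1|]ger0_norm ?invr_ge0//.
have h1 : `|Z s| * `|E - 1 - D - 2^-1 * q| <= B * (e / 2 / B * m) by rewrite ler_pM.
have h2 : `|Z s - z| * `|q| <= e * m by rewrite ler_pM.
have h3 : B * (e / 2 / B * m) = 2^-1 * (e * m) by field; rewrite gt_eqF.
have half : 0 <= 2^-1 :> R by rewrite invr_ge0.
apply: le_trans (lerD h1 (ler_wpM2l half h2)) _.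
by rewrite h3 -mulrDl (_ : 2^-1 + 2^-1 = 1) ?mul1r//; field.
Qed.

Lemma doleans_dade_solves T : solves Pi X Z T.
Proof.
move=> t t0 tT.
apply: (@psum_vanish _ _ Pi_partition Pi_mesh T _
  (fun x y => sq_incr X x y - (Q y - Q x))
  (fun x y => sq_incr X x y + (Q y - Q x)) (fun t => 2 * Q t)) t0 tT.
- exact: near_additive_linear_error Xc doleans_dade_cadlag.
- exact: doleans_dade_vanishes_left.
- exact: (sq_qv_vanishes_left X_QV).
- by move=> x y x0 xy _; rewrite addr_ge0 ?sqr_ge0// subr_ge0 Qm// ltW.
- move=> {t} s t s0 st _.
  apply: (@cvg_to0 _ _ _ _ (fun n => psum (Pi n) (sq_incr X) s t - (Q t - Q s))
    ((Q t - Q s) - (Q t - Q s))).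
  + by move=> n; rewrite psumB// psum_telescope.
  + by rewrite subrr.
  + apply: cvgB; last exact: cvg_cst.
    exact: (cvg_psum_sq Pi_partition Pi_mesh X_QV).
- move=> {t} s t e s0 st _ e0.
  have := psum_sq_le Pi_partition Pi_mesh X_QV s0 st e0.
  apply: filterS => n; rewrite psumD// psum_telescope// -/Q; lra.
- move=> u e u0 uT e0; have Zc := doleans_dade_cadlag.
  have B0 : 0 < `|Z u| + 1 by rewrite ltr_wpDl.
  have [eta eta0 H] := doleans_dade_local (Z u) e0 B0.
  have [d1 d10 Xd] := cadlag_right_osc Xc u0 eta0.
  have [d2 d20 Qd] := cadlag_right_osc Qc u0 eta0.
  have [d3 d30 Zd] := cadlag_right Zc u0 e0.
  have [d4 d40 Zd1] := cadlag_right Zc u0 ltr01.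
  pose d := Num.min (Num.min d1 d2) (Num.min d3 d4).
  have d0 : 0 < d by rewrite !lt_min d10 d20 d30 d40.
  have [dd1 dd2 dd3 dd4] : [/\ d <= d1, d <= d2, d <= d3 & d <= d4].
    by rewrite /d !ge_min !lexx !orbT.
  exists d => //; exists (2^-1 * Z u) => x y ux xy yd _.
  have up z r : d <= r -> z < u + d -> z < u + r.
    by move=> dr zd; rewrite (lt_le_trans zd)// lerD2l.
  have ranges r : d <= r -> (u <= x < u + r) && (u <= y < u + r).
    by move=> dr; rewrite ux (le_trans ux (ltW xy)) (up y)// (up x)// (lt_trans xy).
  have /andP[x1 y1] := ranges _ dd1; have /andP[x2 y2] := ranges _ dd2.
  have /andP[x3 y3] := ranges _ dd3; have /andP[x4 y4] := ranges _ dd4.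
  apply: H.
  + exact: le_trans ux.
  + exact: ltW.
  + move=> v /andP[xv vy]; apply: (jump_le_oscillation u0 Xd).
    by rewrite (le_lt_trans ux xv) (le_lt_trans vy)//; case/andP: y1.
  + exact: Xd.
  + by apply: le_trans (ler_norm _) _; exact: Qd.
  + by have := Zd1 x x4; have := lerB_dist (Z x) (Z u); lra.
  + exact: Zd.
- move=> u e u0 uT e0; have Zc := doleans_dade_cadlag.
  have B0 : 0 < `|left_lim Z u| + 1 by rewrite ltr_wpDl.
  have [eta eta0 H] := doleans_dade_local (left_lim Z u) e0 B0.
  have [d1 d10 Xd] := cadlag_left_osc Xc u0 eta0.
  have [d2 d20 Qd] := cadlag_left_osc Qc u0 eta0.
  have [d3 d30 Zd] := cadlag_left Zc u0 e0.
  have [d4 d40 Zd1] := cadlag_left Zc u0 ltr01.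
  pose d := Num.min (Num.min d1 d2) (Num.min d3 d4).
  have d0 : 0 < d by rewrite !lt_min d10 d20 d30 d40.
  have [dd1 dd2 dd3 dd4] : [/\ d <= d1, d <= d2, d <= d3 & d <= d4].
    by rewrite /d !ge_min !lexx !orbT.
  exists d => //; exists (2^-1 * left_lim Z u) => x y x0 ux xy yu.
  have lo z r : d <= r -> u - d < z -> u - r < z.
    by move=> dr; apply: le_lt_trans; rewrite lerD2l lerN2.
  have ranges r : d <= r -> (u - r < x < u) && (u - r < y < u).
    by move=> dr; rewrite yu (lt_trans xy yu) (lo x)// (lo y)// (lt_trans ux).
  have /andP[x1 y1] := ranges _ dd1; have /andP[x2 y2] := ranges _ dd2.
  have /andP[x3 y3] := ranges _ dd3; have /andP[x4 y4] := ranges _ dd4.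
  apply: H.
  + exact: x0.
  + exact: ltW.
  + move=> v /andP[xv vy]; apply: (@jump_le_oscillation _ x (u - x) x0) => [a b|].
      rewrite subrKC => /andP[xa au] /andP[xb bu]; apply: Xd; apply/andP; split=> //.
        by case/andP: x1 => + _; lra.
      by case/andP: x1 => + _; lra.
    by rewrite subrKC xv (le_lt_trans vy).
  + exact: Xd.
  + by apply: le_trans (ler_norm _) _; exact: Qd.
  + by have := Zd1 x x4; have := lerB_dist (Z x) (left_lim Z u); lra.
  + exact: Zd.
Qed.

Lemma doleans_dade_solution : linear_solution Pi X Z.
Proof.
split; first exact: doleans_dade_admissible.
move=> t t0.
have Zs : ito_sum (Pi n) Z X t @[n --> \oo] --> Z t - 1.
  have := doleans_dade_solves t0 (lexx t) => Z0.
  have -> : (fun n => ito_sum (Pi n) Z X t) =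
      (fun n => (Z t - Z 0) - psum (Pi n) (linear_error X Z) 0 t).
    apply/funext => n; have P := Pi_partition n.
    rewrite ito_sumE// -(psum_telescope P Z (lexx 0) t0) -psumB//.
    by apply: eq_psum => // x y _ _ _; rewrite /linear_error; ring.
  rewrite (_ : Z t - 1 = (Z t - Z 0) - 0); last by rewrite doleans_dade_start subr0.
  apply: cvgB; [exact: cvg_cst|exact: Z0].
split; first by rewrite /ito_integrable; apply/cvg_ex; exists (Z t - 1); exact: Zs.
by rewrite /ito_integral (cvg_lim _ Zs)// addrC subrK.
Qed.

End existence.


Theorem proposition3p1 (R : realType) (Pi : nat -> nat -> R) (X : R -> R)
    (Pi_partition : forall n, is_partition (Pi n))
    (Pi_mesh : mesh (Pi n) @[n --> \oo] --> 0%E)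
    (X_QV : QV Pi X) :
  linear_solution Pi X (doleans_dade Pi X) /\
  (forall Y : R -> R, linear_solution Pi X Y ->
     forall t : R, 0 <= t -> Y t = doleans_dade Pi X t).
Proof.
have Zsol := doleans_dade_solution Pi_partition Pi_mesh X_QV.
split=> // Y Ysol t t0.
exact: (linear_solution_unique Pi_partition Pi_mesh X_QV Ysol Zsol t0).
Qed.
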